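(* Let $G$ be a countable discrete abelian group and $\theta$ an injective group endomorphism of $G$ with finite cokernel such that $\bigcap_{n\in\mathbb{N}}\theta^n(G)=\{1_G\}$, and consider the algebraic dynamical system $(G,\mathbb{N},\theta)$. If $f\in C(\widehat{G},\mathbb{T})$ satisfies $f(1_{\widehat{G}})\neq1$, then $\beta_f$ is an outer automorphism of $\mathcal{Q}(G\rtimes_\theta\mathbb{N})$.
   Context: $\mathcal{Q}(G\rtimes_\theta\mathbb{N})$ is the universal $C^*$-algebra generated by a unitary representation $u$ of $G$ and an isometry $s$ satisfying $su_g=u_{\theta(g)}s$ for $g\in G$, $s^*u_gs=0$ for $g\notin\theta(G)$, and $\sum_{[g]\in G/\theta(G)}u_gss^*u_g^*=1$. The $C^*$-subalgebra generated by $\{u_g\mid g\in G\}$ is a copy of $C^*(G)$, identified with $C(\widehat{G})$ via $u_g\mapsto[\chi\mapsto\chi(g)]$, where $\widehat{G}$ is the Pontryagin dual of $G$ with unit $1_{\widehat{G}}$ (the trivial character). Thus each $f\in C(\widehat{G},\mathbb{T})$ is a unitary in $C^*(G)\subset\mathcal{Q}(G\rtimes_\theta\mathbb{N})$, and $\beta_f$ is the automorphism of $\mathcal{Q}(G\rtimes_\theta\mathbb{N})$ determined by $\beta_f(u_g)=u_g$ for $g\in G$ and $\beta_f(s)=fs$. An automorphism is outer if it is not of the form ${\rm Ad}(w)$ for a unitary $w$ in the algebra. *)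

(* Defs.v *)
From HB Require Import structures.
From mathcomp Require Import all_boot all_order all_algebra.
From mathcomp Require Import complex.
From mathcomp Require Import all_classical all_reals all_analysis.

Set Implicit Arguments.
Unset Strict Implicit.
Unset Printing Implicit Defensive.

Import Order.TTheory GRing.Theory Num.Theory.
Import numFieldNormedType.Exports.

Local Open Scope classical_set_scope.
Local Open Scope ring_scope.
Local Open Scope complex_scope.

(* Unital, nonzero complex C*-algebras. As in every normed module over R[i],
   the norm takes its values in the nonnegative reals of R[i]. The library has
   no join of rings and normed modules, so the product is a field of the mixin;
   the ring and algebra structures are derived from it right below, and only
   the standard notations [1] and [x * y] are used afterwards. *)
HB.mixin Record isCStarAlgebra (R : realType) A
    of CompleteNormedModule R[i] A := {
  cstar_one : A;
  cstar_mul : A -> A -> A;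
  cstar_mulA : associative cstar_mul;
  cstar_mul1x : left_id cstar_one cstar_mul;
  cstar_mulx1 : right_id cstar_one cstar_mul;
  cstar_mulDl : left_distributive cstar_mul +%R;
  cstar_mulDr : right_distributive cstar_mul +%R;
  cstar_one_neq0 : cstar_one != 0;
  cstar_scaleAl : forall (a : R[i]) (x y : A),
    a *: cstar_mul x y = cstar_mul (a *: x) y;
  cstar_scaleAr : forall (a : R[i]) (x y : A),
    a *: cstar_mul x y = cstar_mul x (a *: y);
  cstar_normM : forall x y : A, `|cstar_mul x y| <= `|x| * `|y|;
  star : A -> A;
  starK : involutive star;
  starD : {morph star : x y / x + y};
  starZ : forall (a : R[i]) (x : A), star (a *: x) = Num.conj a *: star x;
  starM : forall x y : A, star (cstar_mul x y) = cstar_mul (star y) (star x);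
  cstar_identity : forall x : A, `|cstar_mul (star x) x| = `|x| ^+ 2
}.

#[short(type="cstarAlgType")]
HB.structure Definition CStarAlgebra (R : realType) :=
  {A of CompleteNormedModule R[i] A & isCStarAlgebra R A}.

Section AlgebraInstances.
Variables (R : realType) (A : cstarAlgType R).

#[non_forgetful_inheritance]
HB.instance Definition _ := GRing.Zmodule_isNzRing.Build A
  (@cstar_mulA R A) (@cstar_mul1x R A) (@cstar_mulx1 R A)
  (@cstar_mulDl R A) (@cstar_mulDr R A) (@cstar_one_neq0 R A).
#[non_forgetful_inheritance]
HB.instance Definition _ := GRing.Lmodule_isLalgebra.Build R[i] A
  (@cstar_scaleAl R A).
#[non_forgetful_inheritance]
HB.instance Definition _ := GRing.Lalgebra_isAlgebra.Build R[i] A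
  (@cstar_scaleAr R A).

End AlgebraInstances.

Section CStar.
Context {R : realType}.

Definition unitary (A : cstarAlgType R) (w : A) : Prop :=
  star w * w = 1 /\ w * star w = 1.

Definition star_morphism (A B : cstarAlgType R) (phi : A -> B) : Prop :=
  [/\ linear phi, monoid_morphism phi & {morph phi : x / star x}].

Definition automorphism (A : cstarAlgType R) (phi : A -> A) : Prop :=
  star_morphism phi /\ bijective phi.

Definition outer (A : cstarAlgType R) (phi : A -> A) : Prop :=
  ~ exists w : A, unitary w /\ forall x, phi x = w * x * star w.

Definition cstar_subalgebra (A : cstarAlgType R) (B : set A) : Prop :=
  [/\ closed B,
      B 0,
      forall (a : R[i]) x y, B x -> B y -> B (a *: x + y),
      forall x y, B x -> B y -> B (x * y)
    & forall x, B x -> B (star x)].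

Definition cstar_generated (A : cstarAlgType R) (S : set A) : set A :=
  smallest (@cstar_subalgebra A) S.

End CStar.

(* Abelian groups are written additively, so that 1_G is 0 : G. *)

(* The dual group of the discrete group G, with the topology of pointwise
   convergence; [dual R G] is used as a type through [set_type]. *)
Definition dual (R : realType) (G : zmodType) : set {ptws G -> R[i]^o} :=
  [set chi | (forall g h, chi (g + h) = chi g * chi h)
             /\ (forall g, `|chi g| = 1)].
Arguments dual : clear implicits.

Lemma trivial_character_subproof (R : realType) (G : zmodType) :
  (fun=> 1) \in dual R G.
Proof. by apply/mem_set; split=> *; rewrite ?mulr1 ?normr1. Qed.

Definition trivial_character (R : realType) (G : zmodType) : dual R G :=
  exist _ (fun=> 1) (trivial_character_subproof R G).

Section Algebra.
Context {R : realType} {G : zmodType} (theta : {additive G -> G}).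

(* G / theta(G), as the set of all cosets of theta(G). *)
Definition cokernel : set (set G) :=
  range (fun g => [set g + theta h | h in [set: G]]).

(* The summand u_g s s^* u_g^* only depends on the coset of g, by the relation
   s u_g = u_(theta g) s; [xget 0 c] is a chosen element of the coset c. *)
Record defining_relations (A : cstarAlgType R) (u : G -> A) (s : A) : Prop := {
  rel_unitary : forall g, unitary (u g);
  rel_mul : forall g h, u (g + h) = u g * u h;
  rel_isometry : star s * s = 1;
  rel_intertwine : forall g, s * u g = u (theta g) * s;
  rel_orthogonal : forall g, ~ range theta g -> star s * u g * s = 0;
  rel_sum : \sum_(c \in cokernel)
      (u (xget 0 c) * s * star s * star (u (xget 0 c))) = 1
}.

(* (Q, u, s) is the universal C*-algebra Q(G x|_theta N) with its canonical
   generators. *)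
Record is_universal (Q : cstarAlgType R) (u : G -> Q) (s : Q) : Prop := {
  universal_relations : defining_relations u s;
  universal_generated : cstar_generated (range u `|` [set s]) = [set: Q];
  universal_property : forall (B : cstarAlgType R) (v : G -> B) (t : B),
    defining_relations v t ->
    exists! phi : Q -> B,
      [/\ star_morphism phi, forall g, phi (u g) = v g & phi s = t]
}.

(* iota is the *-isomorphism from C(dual R G) onto the C*-subalgebra generated
   by the u_g which maps [chi |-> chi g] to u_g. Its values at discontinuous
   functions are irrelevant. *)
Record is_identification (A : cstarAlgType R) (u : G -> A)
    (iota : (dual R G -> R[i]^o) -> A) : Prop := {
  ident_linear : forall (a : R[i]) (f1 f2 : dual R G -> R[i]^o),
    continuous f1 -> continuous f2 ->
    iota (fun chi => a * f1 chi + f2 chi) = a *: iota f1 + iota f2;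
  ident_mul : forall f1 f2 : dual R G -> R[i]^o,
    continuous f1 -> continuous f2 ->
    iota (fun chi => f1 chi * f2 chi) = iota f1 * iota f2;
  ident_star : forall f : dual R G -> R[i]^o, continuous f ->
    iota (fun chi => Num.conj (f chi : R[i])) = star (iota f);
  ident_inj : forall f1 f2 : dual R G -> R[i]^o,
    continuous f1 -> continuous f2 -> iota f1 = iota f2 -> f1 = f2;
  ident_range : iota @` [set f | continuous f] = cstar_generated (range u);
  ident_eval : forall g, iota (fun chi => val chi g) = u g
}.

(* beta is the automorphism fixing every u_g and mapping s to F s; beta_f is
   the case F = iota f. *)
Definition is_beta (A : cstarAlgType R) (u : G -> A) (s F : A)
    (beta : A -> A) : Prop :=
  [/\ automorphism beta, forall g, beta (u g) = u g & beta s = F * s].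

End Algebra.

(* Main.v *)
Require Import Defs.
From HB Require Import structures.
From mathcomp Require Import all_boot all_order all_algebra.
From mathcomp Require Import complex.
From mathcomp Require Import all_classical all_reals all_analysis.
From mathcomp Require Import lra zify.
Set Implicit Arguments.
Unset Strict Implicit.
Unset Printing Implicit Defensive.
Import Order.TTheory GRing.Theory Num.Theory.
Import numFieldNormedType.Exports.
Local Open Scope classical_set_scope.
Local Open Scope ring_scope.
Local Open Scope complex_scope.

(** Suppose that the automorphism is conjugation by a unitary w. As it fixes all
    u_g and maps s to F s, where F is the unitary of the group algebra that
    corresponds to f, w commutes with all u_g and w s = F s w.

    The core of the proof is that w lies in the group algebra, that is, w is a
    continuous function on the dual group. Given this, insert the relation that
    the range projections of the u_c s add up to 1, where c runs over the cosets
    of theta(G): it yields w = F alpha(w), where alpha is the endomorphism of the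
    group algebra induced by theta ([shift_endo_intertwine]). In terms of
    functions, alpha is composition with the dual map of theta, which fixes the
    trivial character; hence evaluation at the trivial character gives
    w(1) = f(1) w(1) ([eps_shift_endo]). As w is unitary, w(1) is not 0, so
    f(1) = 1, a contradiction.

    To see that w lies in the group algebra, consider for z on the unit circle
    the gauge morphism that fixes all u_g and maps s to z s; it exists by
    universality. The image of w satisfies the same commutation rules as w, so
    the quotient of the two commutes with all u_g and s. Such elements are
    scalars: compressions by powers of s fix them and turn every monomial
    u_a s^p s^*q u_b into a scalar in the limit, since the images of the iterates
    of theta have trivial intersection ([central_near_scalar]). So w is an
    eigenvector of all gauge morphisms. Averaging the iterates of a gauge
    morphism of large finite order shows that w is a limit of combinations of
    monomials of one degree p - q ([homogeneous_approximation]). The degree is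
    0: conjugation by u_g, with g = theta^n(h) and n large, multiplies such
    combinations by a fixed u_k, where k <> 0 if the degree is not 0, whereas it
    fixes w; but 1 - u_k has norm at least 1 ([unitary_commutant_degree]).
    Finally, averaging the conjugates by representatives of the cosets of
    theta^n(G) fixes w and maps monomials of degree 0 into the group algebra
    ([diagonal_near_group_algebra]), which is closed.

    Two analytic facts are needed: *-morphisms and the trivial character are
    bounded. Both follow from the existence of square roots of 1 - x^2 for small
    self-adjoint x ([square_root_exists], [seminorm_bounded]).

    All this assumes G <> 0. If G = 0, then s is a unitary that generates the
    algebra, which is therefore commutative, and w s = F s w implies F = 1. *)

(** * The norm as a real number *)

Section RealNorm.
Context {R : realType}.

(** The norm of a module over the complex numbers is a nonnegative element of
    the partially ordered field of complex numbers; its real part carries the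
    same information and is accessible to linear arithmetic. *)
Definition rnorm {V : normedZmodType R[i]} (x : V) : R := complex.Re `|x|.

Lemma rnormE (V : normedZmodType R[i]) (x : V) : `|x| = (rnorm x)%:C.
Proof. by rewrite /rnorm RRe_real // ger0_real. Qed.

Lemma rnorm_ge0 (V : normedZmodType R[i]) (x : V) : 0 <= rnorm x.
Proof. by rewrite -lecR -rnormE normr_ge0. Qed.

Lemma rnormD (V : normedZmodType R[i]) (x y : V) : rnorm (x + y) <= rnorm x + rnorm y.
Proof. by rewrite -lecR rmorphD /= -!rnormE ler_normD. Qed.

Lemma rnormN (V : normedZmodType R[i]) (x : V) : rnorm (- x) = rnorm x.
Proof. by rewrite /rnorm normrN. Qed.

Lemma rnormB (V : normedZmodType R[i]) (x y : V) : rnorm (x - y) = rnorm (y - x).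
Proof. by rewrite /rnorm distrC. Qed.

Lemma rnorm0 (V : normedZmodType R[i]) : rnorm (0 : V) = 0.
Proof. by rewrite /rnorm normr0. Qed.

Lemma rnorm_eq0 (V : normedZmodType R[i]) (x : V) : rnorm x = 0 -> x = 0.
Proof. by move=> h; apply/eqP; rewrite -normr_eq0 rnormE h. Qed.

Lemma rnormZ (V : normedModType R[i]) a (x : V) : rnorm (a *: x) = rnorm a * rnorm x.
Proof.
have := normrZ a x; rewrite !rnormE -rmorphM /=.
by move=> /(congr1 (@complex.Re R)).
Qed.

Lemma rnorm_scalarM (a b : R[i]) : rnorm (a * b) = rnorm a * rnorm b.
Proof. by have := normrM a b; rewrite !rnormE -rmorphM /= => -[]. Qed.

Lemma rnorm1 : rnorm (1 : R[i]) = 1.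
Proof. by rewrite /rnorm normr1. Qed.

Lemma rnorm_real (r : R) : rnorm (r%:C) = `|r|.
Proof. by rewrite /rnorm normc_def /= expr0n addr0 sqrtr_sqr. Qed.

Lemma rnorm_small (V : normedZmodType R[i]) (x : V) :
  (forall e : R, 0 < e -> rnorm x <= e) -> x = 0.
Proof.
move=> h; apply: rnorm_eq0; apply/eqP; rewrite eq_le rnorm_ge0 andbT.
by apply/ler_addgt0Pr => e /h; rewrite add0r.
Qed.

Lemma nbhs_rnorm (V : normedModType R[i]) (x : V) (e : R) : 0 < e ->
  nbhs x [set y | rnorm (x - y) < e].
Proof.
move=> e0; apply/nbhs_normP; exists (e%:C); first by rewrite /= ltcR.
by move=> y /=; rewrite rnormE ltcR.
Qed.

Lemma nbhs_rnormP (V : normedModType R[i]) (x : V) (P : set V) : nbhs x P ->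
  exists2 e : R, 0 < e & forall y, rnorm (x - y) < e -> P y.
Proof.
move=> /nbhs_normP[e /= e0 h]; have eE : e = (complex.Re e)%:C.
  by rewrite RRe_real // gtr0_real.
exists (complex.Re e); first by rewrite -ltcR -eE.
by move=> y xy; apply: h => /=; rewrite rnormE eE ltcR.
Qed.

Lemma closed_rnormP (V : normedModType R[i]) (P : set V) :
  closed P <-> forall x,
    (forall e : R, 0 < e -> exists2 y, P y & rnorm (x - y) < e) -> P x.
Proof.
split=> [clP x h|h x clx].
  apply: clP => B /nbhs_rnormP[e e0 eB]; have [y Py xy] := h e e0.
  by exists y; split=> //; apply: eB.
apply: h => e /(nbhs_rnorm x)/clx[y [Py xy]]; by exists y.
Qed.

Lemma half_pow_small (C e : R) : 0 < e ->
  exists n0, forall n, (n0 <= n)%N -> C * 2^-1 ^+ n < e.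
Proof.
move=> e0.
have : C * 2^-1 ^+ n @[n --> \oo] --> C * 0.
  by apply: cvgM; [exact: cvg_cst|apply: cvg_expr; rewrite ger0_norm; lra].
rewrite mulr0 => /cvgrPdist_lt/(_ e e0)[n0 _ h].
exists n0 => n /h; rewrite sub0r normrN; apply: le_lt_trans; exact: ler_norm.
Qed.

(** Completeness, in the one form needed: the increments of the fixed point
    iteration for square roots decay geometrically. *)
Lemma geometric_cvg (V : completeNormedModType R[i]) (z : nat -> V) (C : R) :
  (forall n, rnorm (z n.+1 - z n) <= C * 2^-1 ^+ n) ->
  exists l, forall e : R, 0 < e ->
    exists n0, forall n, (n0 <= n)%N -> rnorm (l - z n) < e.
Proof.
move=> hz.
have C0 : 0 <= C by move: (hz 0%N); rewrite expr0 mulr1; apply: le_trans (rnorm_ge0 _).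
have tail n k : rnorm (z (n + k)%N - z n) <= 2 * C * 2^-1 ^+ n - 2 * C * 2^-1 ^+ (n + k).
  elim: k => [|k IH]; first by rewrite addn0 !subrr rnorm0.
  have := rnormD (z (n + k).+1 - z (n + k)%N) (z (n + k)%N - z n).
  rewrite addrA subrK addnS exprS; have := hz (n + k)%N; lra.
have {}tail n m : (n <= m)%N -> rnorm (z m - z n) <= 2 * C * 2^-1 ^+ n.
  move=> /subnKC <-; apply: le_trans (tail _ _) _.
  by rewrite gerBl mulr_ge0 ?exprn_ge0 ?mulr_ge0 // invr_ge0.
have : cauchy (z @ \oo).
  apply/cauchyP => e e0.
  have eE : e = (complex.Re e)%:C by rewrite RRe_real // gtr0_real.
  have e0' : 0 < complex.Re e by rewrite -ltcR -eE.
  have [n0 hn0] := half_pow_small (2 * C) e0'.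
  exists (z n0); exists n0 => //= m n0m.
  rewrite -ball_normE /= rnormE eE ltcR rnormB.
  by apply: le_lt_trans (tail _ _ n0m) (hn0 _ _).
move=> /cauchy_cvgP/cvg_ex[l hl]; exists l => e e0.
have /hl[n0 _ hn] := nbhs_rnorm l e0; exists n0 => n /hn; exact.
Qed.

End RealNorm.

(** * Square roots in C*-algebras *)

Section CStarBasics.
Context {R : realType} {A : cstarAlgType R}.
Implicit Types x y a b z : A.

Lemma rnormM x y : rnorm (x * y) <= rnorm x * rnorm y.
Proof. by rewrite -lecR rmorphM /= -!rnormE; exact: cstar_normM. Qed.

Lemma cstarE x : rnorm (star x * x) = rnorm x ^+ 2.
Proof.
have := @cstar_identity R A x; rewrite -/(star x * x) !rnormE -rmorphXn /=.
by move=> [].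
Qed.

Lemma star_mul x y : star (x * y) = star y * star x.
Proof. exact: starM. Qed.

Lemma star1 : star 1 = 1 :> A.
Proof. by rewrite -[LHS]mulr1 -{2}[1](starK 1) -star_mul mulr1 starK. Qed.

Lemma star0 : star 0 = 0 :> A.
Proof. by apply: (addrI (star 0)); rewrite addr0 -starD addr0. Qed.

Lemma starN x : star (- x) = - star x.
Proof. by apply: (addrI (star x)); rewrite -starD !subrr star0. Qed.

Lemma starB x y : star (x - y) = star x - star y.
Proof. by rewrite starD starN. Qed.

Lemma rnorm_star x : rnorm (star x) = rnorm x.
Proof.
have le y : rnorm y <= rnorm (star y).
  have [y0|y0] := eqVneq (rnorm y) 0; first by rewrite y0 rnorm_ge0.
  have yp : 0 < rnorm y by rewrite lt_def y0 rnorm_ge0.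
  by rewrite -(ler_pM2r yp) -expr2 -cstarE rnormM.
by apply/eqP; rewrite eq_le -{2}[x](starK x) !le.
Qed.

Lemma rnorm_one : rnorm (1 : A) = 1.
Proof.
have h := cstarE 1; rewrite star1 mulr1 in h.
have : rnorm (1 : A) * (rnorm (1 : A) - 1) = 0 by lra.
move=> /eqP; rewrite mulf_eq0 subr_eq0 => /orP[/eqP h0|/eqP //].
by move/rnorm_eq0/eqP: h0; rewrite oner_eq0.
Qed.

Lemma rnorm_unitary a : unitary a -> rnorm a = 1.
Proof.
move=> [h _]; have := cstarE a; rewrite h rnorm_one => /esym/eqP.
by rewrite sqrp_eq1 ?rnorm_ge0 // => /eqP.
Qed.

Lemma rnorm_isometry a : star a * a = 1 -> rnorm a = 1.
Proof.
move=> h; have := cstarE a; rewrite h rnorm_one => /esym/eqP.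
by rewrite sqrp_eq1 ?rnorm_ge0 // => /eqP.
Qed.

(** The elements a + ib and a - ib are adjoint to each other and both have
    squared norm |a^2 + b^2|, while a is half their sum. *)
Lemma square_le_sum_squares a b : star a = a -> star b = b -> a * b = b * a ->
  rnorm a ^+ 2 <= rnorm (a * a + b * b).
Proof.
move=> sa sb ab; pose j : R[i] := 'i.
have jj : j * j = -1 by rewrite -expr2 sqr_i.
have cj : Num.conj j = - j by apply: conjCi.
have h (t : R[i]) : t * t = -1 -> Num.conj t = - t ->
    rnorm (a + t *: b) ^+ 2 = rnorm (a * a + b * b).
  move=> tt ct; rewrite -cstarE; congr rnorm.
  rewrite starD starZ ct sa sb mulrDl !mulrDr -!scalerAl -!scalerAr scalerA.
  by rewrite mulNr tt opprK scale1r ab scaleNr addrA addrK.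
have h1 := h j jj cj; have h2 := h (- j).
have {}h2 : rnorm (a - j *: b) ^+ 2 = rnorm (a * a + b * b).
  by rewrite -scaleNr h2 ?mulrNN ?rmorphN /= ?cj.
have h3 : rnorm (a + j *: b) = rnorm (a - j *: b).
  by apply/eqP; rewrite -(eqrXn2 (n := 2)) ?rnorm_ge0 // h1 h2.
have := rnormD (a + j *: b) (a - j *: b).
rewrite addrACA subrr addr0 -h3.
have -> : a + a = ((2 : R)%:C) *: a by rewrite rmorphD /= scalerDl scale1r.
rewrite rnormZ rnorm_real normr_nat -h1 => h4.
have := rnorm_ge0 a; have := rnorm_ge0 (a + j *: b); nra.
Qed.

Section SquareRoot.
Variables (B : set A) (Bsub : cstar_subalgebra B) (B1 : B 1).
Variables (x : A) (Bx : B x) (sx : star x = x) (x_small : rnorm x <= 2^-1).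

Let half : R[i] := (2^-1 : R)%:C.

Let step (z : A) := half *: (x * x + z * z).
Let zs n := iter n step 0.

Let half2 : half + half = 1.
Proof. by rewrite /half -rmorphD /= (_ : _ + _ = 1) //; lra. Qed.

Let sub_closed y z : B y -> B z -> B (y + z).
Proof. by case: Bsub => _ _ hl _ _ By Bz; rewrite -[y]scale1r; exact: hl. Qed.

(** The element y = 1 - z is a square root of 1 - x^2 as soon as
    z = (x^2 + z^2) / 2. The iteration of this equation from 0 stays in the ball
    of radius 1/2, on which the right-hand side contracts by a factor 1/2; its
    terms lie in B, are self-adjoint and commute with x. *)
Lemma square_root_exists : exists y,
  [/\ B y, star y = y, x * y = y * x & x * x + y * y = 1].
Proof.
case: (Bsub) => clB B0 Bl Bm Bs.
have zsS n : zs n.+1 = half *: (x * x + zs n * zs n) by [].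
have zs0 : zs 0 = 0 by []. clearbody zs.
have zsP n : [/\ B (zs n), star (zs n) = zs n, x * zs n = zs n * x,
    rnorm (zs n) <= 2^-1 & zs n * zs n.+1 = zs n.+1 * zs n].
  elim: n => [|n [Bn sn xn bn cn]].
    by split; rewrite zs0 ?star0 ?mulr0 ?mul0r ?rnorm0 ?invr_ge0.
  have xx : x * zs n.+1 = zs n.+1 * x.
    rewrite zsS -scalerAr -scalerAl mulrDr mulrDl; congr (_ *: (_ + _)).
      by rewrite mulrA.
    by rewrite mulrA xn -mulrA xn mulrA.
  split => //.
  - by rewrite zsS -[_ *: _]addr0; apply: Bl => //; apply: sub_closed; exact: Bm.
  - rewrite zsS starZ starD !star_mul sn sx; congr (_ *: _).
    by apply: conj_Creal; apply/complex_realP; exists 2^-1.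
  - rewrite zsS rnormZ rnorm_real.
    have := rnormD (x * x) (zs n * zs n); have := rnormM x x; have := rnormM (zs n) (zs n).
    have := ler_pM (rnorm_ge0 _) (rnorm_ge0 _) x_small x_small.
    have := ler_pM (rnorm_ge0 _) (rnorm_ge0 _) bn bn.
    rewrite ger0_norm ?invr_ge0 //; lra.
  - rewrite (zsS n.+1).
    rewrite -scalerAr -scalerAl mulrDr mulrDl !mulrA; congr (_ *: (_ + _)).
    by rewrite -xx -!mulrA xx.
have diff n : rnorm (zs n.+2 - zs n.+1) <= 2^-1 * rnorm (zs n.+1 - zs n).
  have [_ _ _ b1 c] := zsP n; have [_ _ _ b2 _] := zsP n.+1.
  have -> : zs n.+2 - zs n.+1 = half *: ((zs n.+1 + zs n) * (zs n.+1 - zs n)).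
    rewrite (zsS n.+1) {3}(zsS n) -scalerBr; congr (_ *: _).
    by rewrite mulrBr !mulrDl c addrKA [x * x + _]addrC addrKA.
  rewrite rnormZ rnorm_real ger0_norm ?invr_ge0 //.
  have := rnormM (zs n.+1 + zs n) (zs n.+1 - zs n); have := rnormD (zs n.+1) (zs n).
  have := rnorm_ge0 (zs n.+1 - zs n); nra.
have geo n : rnorm (zs n.+1 - zs n) <= 2^-1 * 2^-1 ^+ n.
  elim: n => [|n IH]; first by rewrite zs0 subr0 expr0 mulr1; have [_ _ _ + _] := zsP 1.
  by apply: le_trans (diff n) _; rewrite exprS; lra.
have [z hz] := geometric_cvg geo.
have appr e : 0 < e -> exists n, rnorm (z - zs n) < e /\ rnorm (z - zs n.+1) < e.
  by move=> /hz[n h]; exists n; split; exact: h.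
have lim_closed (P : set A) : closed P -> (forall n, P (zs n)) -> P z.
  move=> /closed_rnormP clP Pz; apply: clP => e /appr[n [h _]]; by exists (zs n).
have Bz : B z by apply: lim_closed => // n; have [] := zsP n.
have sz : star z = z.
  apply/eqP; rewrite -subr_eq0; apply/eqP/rnorm_small => e e0.
  have /appr[n [h _]] : 0 < e / 2 by lra.
  have [_ sn _ _ _] := zsP n.
  have -> : star z - z = star (z - zs n) - (z - zs n).
    by rewrite starB sn opprB addrA subrK.
  have := rnormD (star (z - zs n)) (- (z - zs n)); rewrite rnorm_star rnormN; lra.
have xz : x * z = z * x.
  apply/eqP; rewrite -subr_eq0; apply/eqP/rnorm_small => e e0.
  have /appr[n [h _]] : 0 < e by lra.
  have [_ _ xn _ _] := zsP n.
  have -> : x * z - z * x = x * (z - zs n) - (z - zs n) * x.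
    by rewrite mulrBr mulrBl xn opprB addrA subrK.
  have := rnormD (x * (z - zs n)) (- ((z - zs n) * x)); rewrite rnormN.
  have := rnormM x (z - zs n); have := rnormM (z - zs n) x; have := rnorm_ge0 (z - zs n).
  have := ler_wpM2r (rnorm_ge0 (z - zs n)) x_small; lra.
have nz : rnorm z <= 2^-1.
  apply/ler_addgt0Pr => e /appr[n [h _]]; have [_ _ _ b _] := zsP n.
  have := rnormD (zs n) (z - zs n); rewrite subrKC; lra.
have fix_z : z = step z.
  apply/eqP; rewrite -subr_eq0; apply/eqP/rnorm_small => e e0.
  have /appr[n [h1 h2]] : 0 < e / 2 by lra.
  have [_ _ _ b _] := zsP n.
  have -> : z - step z = (z - zs n.+1) - half *: ((z - zs n) * z + zs n * (z - zs n)).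
    rewrite zsS /step mulrBl mulrBr addrA subrK.
    by rewrite -[in RHS]addrA -opprD -scalerDr -[x * x + _ + _]addrA subrKC.
  have := rnormD (z - zs n.+1) (- (half *: ((z - zs n) * z + zs n * (z - zs n)))).
  rewrite rnormN rnormZ rnorm_real ger0_norm ?invr_ge0 //.
  have := rnormD ((z - zs n) * z) (zs n * (z - zs n)).
  have := rnormM (z - zs n) z; have := rnormM (zs n) (z - zs n).
  have := ler_wpM2r (rnorm_ge0 (z - zs n)) nz.
  have := ler_wpM2r (rnorm_ge0 (z - zs n)) b; lra.
exists (1 - z); split.
- by rewrite addrC -scaleN1r; exact: Bl.
- by rewrite starB star1 sz.
- by rewrite mulrBr mulrBl mulr1 mul1r xz.
- have e1 : x * x + z * z = z + z.
    by rewrite {3 4}fix_z /step -scalerDl half2 scale1r.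
  by rewrite mulrBr mulr1 mulrBl mul1r opprB addrCA [x * x + _]addrA e1 addrK subrK.
Qed.
End SquareRoot.
End CStarBasics.

(** * Bounded linear maps and morphisms *)

Section Bounded.
Context {R : realType}.

Definition bounded_linear (V W : normedModType R[i]) (f : V -> W) : Prop :=
  linear f /\ exists K : R, forall x, rnorm (f x) <= K * rnorm x.

Definition closed_subspace (V : normedModType R[i]) (P : set V) : Prop :=
  [/\ closed P, P 0 & forall (a : R[i]) x y, P x -> P y -> P (a *: x + y)].

Section BoundedLinear.
Variables (V W : normedModType R[i]) (f : V -> W).
Hypothesis fbl : bounded_linear f.

Lemma blinD x y : f (x + y) = f x + f y.
Proof. by case: fbl => lf _; have := lf 1 x y; rewrite !scale1r. Qed.

Lemma blin0 : f 0 = 0.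
Proof. by apply: (addrI (f 0)); rewrite -blinD !addr0. Qed.

Lemma blinZ a x : f (a *: x) = a *: f x.
Proof. by case: fbl => lf _; have := lf a x 0; rewrite !addr0 blin0 addr0. Qed.

Lemma blinN x : f (- x) = - f x.
Proof. by rewrite -scaleN1r blinZ scaleN1r. Qed.

Lemma blinB x y : f (x - y) = f x - f y.
Proof. by rewrite blinD blinN. Qed.

Lemma blin_sum (I : Type) (r : seq I) (P : pred I) (F : I -> V) :
  f (\sum_(i <- r | P i) F i) = \sum_(i <- r | P i) f (F i).
Proof. by apply: (big_morph f) => [x y|]; [exact: blinD|exact: blin0]. Qed.

Lemma blin_bound : exists2 K : R, 0 < K & forall x, rnorm (f x) <= K * rnorm x.
Proof.
case: fbl => _ [K h]; exists (Num.max K 1); first by rewrite lt_max ltr01 orbT.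
move=> x; apply: le_trans (h x) _; apply: ler_wpM2r; first exact: rnorm_ge0.
by rewrite le_max lexx.
Qed.

Lemma closed_subspace_preimage (P : set W) :
  closed_subspace P -> closed_subspace [set x | P (f x)].
Proof.
move=> [/closed_rnormP clP P0 Pl]; split.
- apply/closed_rnormP => x hx; apply: clP => e e0; have [K K0 hK] := blin_bound.
  have [y Py xy] := hx (e / K) (divr_gt0 e0 K0); exists (f y) => //.
  rewrite -blinB; apply: le_lt_trans (hK _) _.
  by rewrite mulrC -ltr_pdivlMr.
- by rewrite /= blin0.
- by move=> a x y /= Px Py; rewrite blinD blinZ; exact: Pl.
Qed.

Lemma closed_subspace_ker : closed_subspace [set x | f x = 0].
Proof.
apply: (@closed_subspace_preimage [set 0]); split => //.
- apply/closed_rnormP => x hx; apply: rnorm_small => e /hx[y -> ].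
  by rewrite subr0 => /ltW.
- by move=> a x y -> ->; rewrite scaler0 addr0.
Qed.
End BoundedLinear.

Lemma bounded_linearI (V W : normedModType R[i]) (f : V -> W) (K : R) :
  (forall x y, f (x + y) = f x + f y) -> (forall a x, f (a *: x) = a *: f x) ->
  (forall x, rnorm (f x) <= K * rnorm x) -> bounded_linear f.
Proof. by move=> fD fZ fK; split; [move=> a x y; rewrite fD fZ|exists K]. Qed.

Lemma blin_id (V : normedModType R[i]) : bounded_linear (fun x : V => x).
Proof. by apply: (@bounded_linearI _ _ _ 1) => // x; rewrite mul1r. Qed.

Lemma blin_comp (U V W : normedModType R[i]) (f : V -> W) (g : U -> V) :
  bounded_linear f -> bounded_linear g -> bounded_linear (fun x => f (g x)).
Proof.
move=> fb gb; have [K K0 hK] := blin_bound fb; have [L L0 hL] := blin_bound gb.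
apply: (@bounded_linearI _ _ _ (K * L)) => [x y|a x|x].
- by rewrite (blinD gb) (blinD fb).
- by rewrite (blinZ gb) (blinZ fb).
- apply: le_trans (hK _) _; rewrite -mulrA; apply: ler_wpM2l => //; exact: ltW.
Qed.

Lemma blin_add (V W : normedModType R[i]) (f g : V -> W) :
  bounded_linear f -> bounded_linear g -> bounded_linear (fun x => f x + g x).
Proof.
move=> fb gb; have [K K0 hK] := blin_bound fb; have [L L0 hL] := blin_bound gb.
apply: (@bounded_linearI _ _ _ (K + L)) => [x y|a x|x].
- by rewrite (blinD gb) (blinD fb) addrACA.
- by rewrite (blinZ gb) (blinZ fb) scalerDr.
- by apply: le_trans (rnormD _ _) _; rewrite mulrDl lerD.
Qed.

Lemma blin_scale (V W : normedModType R[i]) (f : V -> W) (a : R[i]) :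
  bounded_linear f -> bounded_linear (fun x => a *: f x).
Proof.
move=> fb; have [K K0 hK] := blin_bound fb.
apply: (@bounded_linearI _ _ _ (rnorm a * K)) => [x y|b x|x].
- by rewrite (blinD fb) scalerDr.
- by rewrite (blinZ fb) !scalerA mulrC.
- by rewrite rnormZ -mulrA; apply: ler_wpM2l => //; exact: rnorm_ge0.
Qed.

Lemma blin_opp (V W : normedModType R[i]) (f : V -> W) :
  bounded_linear f -> bounded_linear (fun x => - f x).
Proof.
move=> /(blin_scale (-1)); congr bounded_linear.
by apply/funext => x; rewrite scaleN1r.
Qed.

Lemma blin_bigsum (V W : normedModType R[i]) (I : Type) (r : seq I) (f : I -> V -> W) :
  (forall i, bounded_linear (f i)) -> bounded_linear (fun x => \sum_(i <- r) f i x).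
Proof.
move=> fb; elim: r => [|i r IH].
  apply: (@bounded_linearI _ _ _ 0) => [x y|a x|x]; rewrite !big_nil.
  - by rewrite addr0.
  - by rewrite scaler0.
  - by rewrite rnorm0 mul0r.
have -> : (fun x => \sum_(j <- i :: r) f j x) = fun x => f i x + \sum_(j <- r) f j x.
  by apply/funext => x; rewrite big_cons.
by apply: blin_add.
Qed.

Lemma closed_subspace_eq (V W : normedModType R[i]) (f g : V -> W) :
  bounded_linear f -> bounded_linear g -> closed_subspace [set x | f x = g x].
Proof.
move=> fb gb.
have -> : [set x | f x = g x] = [set x | f x - g x = 0].
  by apply/seteqP; split=> x /= => [->|/eqP]; rewrite ?subrr // subr_eq0 => /eqP.
by apply: closed_subspace_ker; apply: blin_add => //; exact: blin_opp.
Qed.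

Section Algebra.
Variable A : cstarAlgType R.
Implicit Types (x y : A) (B : set A).

Lemma blin_mull (a : A) : bounded_linear (fun x => a * x).
Proof.
apply: (@bounded_linearI _ _ _ (rnorm a)) => [x y|b x|x].
- exact: mulrDr.
- by rewrite scalerAr.
- exact: rnormM.
Qed.

Lemma blin_mulr (a : A) : bounded_linear (fun x => x * a).
Proof.
apply: (@bounded_linearI _ _ _ (rnorm a)) => [x y|b x|x].
- exact: mulrDl.
- by rewrite scalerAl.
- by rewrite mulrC; exact: rnormM.
Qed.

Lemma blin_mul2 (a b : A) : bounded_linear (fun x => a * x * b).
Proof. exact: blin_comp (blin_mulr b) (blin_mull a). Qed.

Lemma cstar_generated_subalgebra (S : set A) : cstar_subalgebra (cstar_generated S).
Proof.
split.
- by apply: closed_bigI => B [[]].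
- by move=> B [[]].
- by move=> a x y hx hy B BS; case: (BS) => [[_ _ h _ _] _]; apply: h; [exact: hx|exact: hy].
- by move=> x y hx hy B BS; case: (BS) => [[_ _ _ h _] _]; apply: h; [exact: hx|exact: hy].
- by move=> x hx B BS; case: (BS) => [[_ _ _ _ h] _]; apply: h; exact: hx.
Qed.

Lemma sub_generated (S : set A) : S `<=` cstar_generated S.
Proof. by move=> x Sx B [_]; exact. Qed.

Lemma generated_sub (S B : set A) : cstar_subalgebra B -> S `<=` B ->
  cstar_generated S `<=` B.
Proof. by move=> h1 h2 x; apply. Qed.

Lemma subalgebra_closed_subspace B : cstar_subalgebra B -> closed_subspace B.
Proof. by case. Qed.

Lemma closed_subspaceI (P P' : set A) : closed_subspace P -> closed_subspace P' ->
  closed_subspace (P `&` P').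
Proof.
move=> [c1 z1 l1] [c2 z2 l2]; split=> //; first exact: closedI.
by move=> a x y [? ?] [? ?]; split; [exact: l1|exact: l2].
Qed.

(** Induction over a generated C*-algebra: when the products of generators and
    their adjoints with elements of [mon] stay in [mon] or vanish, the smallest
    closed subspace M containing [mon] is stable under left multiplication by
    the generators. The elements b such that b and its adjoint leave M stable
    form a C*-subalgebra, hence all of the generated algebra leaves M stable,
    and it suffices to apply it to 1. *)
Lemma generated_induction (S mon : set A) : mon 1 ->
  (forall g m, S g -> mon m -> g * m = 0 \/ mon (g * m)) ->
  (forall g m, S g -> mon m -> star g * m = 0 \/ mon (star g * m)) ->
  forall P, closed_subspace P -> mon `<=` P -> cstar_generated S `<=` P.
Proof.
move=> mon1 lS lsS P Psub Pmon.
pose M := [set x | forall P, closed_subspace P -> mon `<=` P -> P x].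
have Msub : closed_subspace M.
  split.
  - apply/closed_rnormP => x hx P' sP' mP'; case: (sP') => /closed_rnormP cl _ _.
    by apply: cl => e /hx[y My xy]; exists y => //; exact: My.
  - by move=> P' [].
  - move=> a x y Mx My P' sP' mP'; case: (sP') => _ _; apply; first exact: Mx.
    exact: My.
pose stab := [set b : A | forall x, M x -> M (b * x)].
have stabP b : (forall m, mon m -> b * m = 0 \/ mon (b * m)) -> stab b.
  move=> hb x Mx P' sP' mP'.
  apply: (Mx [set x | P' (b * x)]).
    exact: closed_subspace_preimage (blin_mull b) _ sP'.
  by move=> m /hb[bm|/mP' //] /=; rewrite bm; case: sP'.
have stab_sub : closed_subspace stab.
  have -> : stab = [set b | forall P', (exists2 x, M x & P' = [set b | M (b * x)]) -> P' b].
    apply/seteqP; split => b /= hb; first by move=> _ [x Mx ->]; exact: hb.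
    by move=> x Mx; apply: (hb [set b | M (b * x)]); exists x.
  have h x : closed_subspace [set b | M (b * x)].
    exact: closed_subspace_preimage (blin_mulr x) _ Msub.
  split.
  - apply/closed_rnormP => b hb P' [x Mx ->]; case: (h x) => /closed_rnormP cl _ _.
    apply: cl => e /hb[c hc bc]; exists c => //; apply: (hc _ (ex_intro2 _ _ x Mx erefl)).
  - by move=> _ [x Mx ->]; case: (h x).
  - move=> a b c hb hc P' hP'; case: (hP') => x Mx E; rewrite E.
    case: (h x) => _ _; apply; first by rewrite -E; exact: hb.
    by rewrite -E; exact: hc.
pose T := stab `&` [set b | stab (star b)].
have Tsub : cstar_subalgebra T.
  case: stab_sub => cl s0 sl; split.
  - apply: closedI => //; apply/closed_rnormP => b hb.
    move/closed_rnormP: (cl) => /(_ (star b)); apply => e /hb[c sc bc].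
    by exists (star c) => //; rewrite -starB rnorm_star.
  - by split=> //=; rewrite star0.
  - move=> a x y [sx ssx] [sy ssy]; split; first exact: sl.
    by rewrite /= starD starZ; exact: sl.
  - move=> x y [sx ssx] [sy ssy]; split=> [z Mz|z Mz].
      by rewrite -mulrA; apply: sx; exact: sy.
    by rewrite star_mul -mulrA; apply: ssy; exact: ssx.
  - by move=> x [sx ssx]; split => //=; rewrite starK.
have ST : S `<=` T by move=> g Sg; split; apply: stabP => m; [exact: lS|exact: lsS].
move=> x /(generated_sub Tsub ST)[sx _]; rewrite -[x]mulr1; apply: sx => // P' _; exact.
Qed.

(** For x self-adjoint of norm at most 1/2 there is a self-adjoint y commuting with x
    such that x^2 + y^2 = 1, so a C*-seminorm that is monotone on such sums of
    squares is at most 1 at x; scaling and the C*-identity do the rest. The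
    constant 2 is not optimal, but it is uniform over all seminorms. *)
Lemma seminorm_bounded B (N : A -> R) : cstar_subalgebra B -> B 1 ->
  (forall x, 0 <= N x) ->
  (forall (t : R) x, B x -> 0 <= t -> N (t%:C *: x) = t * N x) ->
  (forall x, B x -> N (star x * x) = N x ^+ 2) ->
  (forall x y, B x -> B y -> star x = x -> star y = y -> x * y = y * x ->
     x * x + y * y = 1 -> N x <= 1) ->
  forall x, B x -> N x <= 2 * rnorm x.
Proof.
move=> Bsub B1 N0 NZ NC Nsq; case: (Bsub) => _ B0 Bl Bm Bs.
have sa x : B x -> star x = x -> N x <= 2 * rnorm x.
  move=> Bx sx; have [x0|x0] := eqVneq (rnorm x) 0.
    rewrite x0 mulr0 (rnorm_eq0 x0).
    by have := NZ 0 0 B0 (lexx _); rewrite scaler0 mul0r => ->.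
  have xp : 0 < rnorm x by rewrite lt_def x0 rnorm_ge0.
  pose t := (2 * rnorm x)^-1; have t0 : 0 < t by rewrite invr_gt0; lra.
  have Bt : B (t%:C *: x) by rewrite -[_ *: _]addr0; exact: Bl.
  have st : star (t%:C *: x) = t%:C *: x.
    rewrite starZ sx; congr (_ *: _); apply: conj_Creal.
    by apply/complex_realP; exists t.
  have nt : rnorm (t%:C *: x) <= 2^-1.
    by rewrite rnormZ rnorm_real gtr0_norm // /t invfM -mulrA mulVf // mulr1.
  have [y [By sy xy xxyy]] := square_root_exists Bsub B1 Bt st nt.
  have := Nsq _ _ Bt By st sy xy xxyy.
  by rewrite (NZ _ _ Bx (ltW t0)) /t ler_pdivrMl ?mulr1 //; lra.
move=> x Bx.
have := sa (star x * x) (Bm _ _ (Bs _ Bx) Bx).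
rewrite star_mul starK NC // cstarE => /(_ erefl) h.
rewrite -(@ler_pXn2r _ 2) ?nnegrE ?mulr_ge0 ?rnorm_ge0 //.
rewrite exprMn; have := sqr_ge0 (rnorm x); lra.
Qed.

End Algebra.

Section Morphism.
Variables (A B : cstarAlgType R) (phi : A -> B).
Hypothesis phiM : star_morphism phi.

Lemma morphD x y : phi (x + y) = phi x + phi y.
Proof. by case: phiM => lf _ _; have := lf 1 x y; rewrite !scale1r. Qed.

Lemma morph1 : phi 1 = 1.
Proof. by case: phiM => _ []. Qed.

Lemma morphM x y : phi (x * y) = phi x * phi y.
Proof. by case: phiM => _ []. Qed.

Lemma morph_star x : phi (star x) = star (phi x).
Proof. by case: phiM. Qed.

Lemma morphZ a x : phi (a *: x) = a *: phi x.
Proof.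
case: phiM => lf _ _; have := lf a x 0; have : phi 0 = 0.
  by apply: (addrI (phi 0)); rewrite -morphD !addr0.
by move=> ->; rewrite !addr0.
Qed.

(** A *-morphism is automatically bounded, with a constant that does not depend
    on the morphism; this uniformity lets averages of many iterates of one
    morphism be controlled. *)
Lemma star_morphism_bounded x : rnorm (phi x) <= 2 * rnorm x.
Proof.
apply: (@seminorm_bounded A setT (fun x => rnorm (phi x))) => //.
- by move=> y; exact: rnorm_ge0.
- by move=> t y _ t0; rewrite morphZ rnormZ rnorm_real ger0_norm.
- by move=> y _; rewrite morphM morph_star cstarE.
- move=> y z _ _ sy sz yz h.
  have := @square_le_sum_squares R B (phi y) (phi z).
  rewrite -!morph_star sy sz -!morphM yz -morphD h morph1 rnorm_one => /(_ erefl erefl erefl).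
  by rewrite expr_le1 ?rnorm_ge0.
Qed.

Lemma star_morphism_blin : bounded_linear phi.
Proof.
exact: (bounded_linearI morphD morphZ star_morphism_bounded).
Qed.
End Morphism.

End Bounded.

(** * The group algebra and its trivial character *)

Section ContinuousFunctions.
Context {R : realType} {T : topologicalType}.
Implicit Types (h k : T -> R[i]^o).

Lemma continuous_lin (a : R[i]) h k : continuous h -> continuous k ->
  continuous (fun t => a * h t + k t : R[i]^o).
Proof.
move=> ch ck t.
exact: (@cvgD R[i] R[i]^o T (nbhs t) _ (a \*: h) k _ _
  (@cvgZl_tmp R[i] R[i]^o T (nbhs t) _ a h _ (ch t)) (ck t)).
Qed.

Lemma continuous_mul h k : continuous h -> continuous k ->
  continuous (fun t => h t * k t : R[i]^o).
Proof.
move=> ch ck t.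
exact: (@cvgM R[i] T (nbhs t) _ h k _ _ (ch t) (ck t)).
Qed.

Lemma continuous_conj h : continuous h ->
  continuous (fun t => Num.conj (h t : R[i]) : R[i]^o).
Proof.
move=> ch t P /(@nbhs_rnormP R R[i]^o)[e e0 eP].
have /ch : nbhs (h t) [set y | rnorm (h t - y : R[i]^o) < e] by exact: nbhs_rnorm.
apply: (@filterS T (nbhs t)) => s /= hp; apply: eP.
rewrite -rmorphB; move: hp; rewrite /rnorm; congr (complex.Re _ < _).
by rewrite norm_conjC.
Qed.
End ContinuousFunctions.

Lemma continuous_eval (R : realType) (G : zmodType) (g : G) :
  continuous (fun chi : dual R G => val chi g : R[i]^o).
Proof.
move=> chi.
apply: (@continuous_comp (dual R G) {ptws G -> R[i]^o} R[i]^o val (fun f => f g)).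
  exact: (@initial_continuous _ _ (val : dual R G -> {ptws G -> R[i]^o})).
exact: (@proj_continuous G (fun _ => R[i]^o) g).
Qed.

Section TrivialCharacter.
Context {R : realType} {G : zmodType} (A : cstarAlgType R) (u : G -> A).
Variable iota : (dual R G -> R[i]^o) -> A.
Hypotheses (iotaP : is_identification u iota) (u0 : u 0 = 1).

Definition group_algebra : set A := cstar_generated (range u).
Notation C := group_algebra.
Let triv := trivial_character R G.

Lemma group_algebra_subalgebra : cstar_subalgebra C.
Proof. exact: cstar_generated_subalgebra. Qed.

Lemma group_algebraP a : C a -> exists2 h, continuous h & iota h = a.
Proof. by rewrite /C -(ident_range iotaP). Qed.

Lemma group_algebra_iota h : continuous h -> C (iota h).
Proof. by move=> ch; rewrite /C -(ident_range iotaP); exists h. Qed.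

Lemma group_algebra_star a : C a -> C (star a).
Proof. by case: group_algebra_subalgebra => _ _ _ _; apply. Qed.

Lemma group_algebra_u g : C (u g).
Proof. by apply: sub_generated; exists g. Qed.

Lemma group_algebra1 : C 1.
Proof. by rewrite -u0; exact: group_algebra_u. Qed.

Lemma group_algebra_comm a b : C a -> C b -> a * b = b * a.
Proof.
move=> /group_algebraP[h ch <-] /group_algebraP[k ck <-].
rewrite -(ident_mul iotaP ch ck) -(ident_mul iotaP ck ch); congr iota.
by apply/funext => chi; exact: mulrC.
Qed.

Lemma iota1 : iota (fun=> 1) = 1.
Proof.
rewrite -u0 -(ident_eval iotaP); congr iota; apply/funext => chi.
have /set_mem[chiM chi1] := valP chi.
have c0 : val chi 0 != 0 by rewrite -normr_eq0 chi1 oner_eq0.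
by apply/esym/(mulfI c0); rewrite -chiM addr0 mulr1.
Qed.

(** Evaluation at the trivial character, read as a functional on the group
    algebra through the identification with continuous functions on the dual
    group; it is the augmentation, which maps every u_g to 1. *)
Definition eps (a : A) : R[i] :=
  xget (fun=> 0) [set h : dual R G -> R[i]^o | continuous h /\ iota h = a] triv.

Lemma eps_iota h : continuous h -> eps (iota h) = h triv.
Proof.
move=> ch; rewrite /eps; case: xgetP => [k -> [ck E]|/(_ h)[]//].
by rewrite (ident_inj iotaP ck ch E).
Qed.

Lemma eps_lin (c : R[i]) a b : C a -> C b -> eps (c *: a + b) = c * eps a + eps b.
Proof.
move=> /group_algebraP[h ch <-] /group_algebraP[k ck <-].
rewrite -(ident_linear iotaP c ch ck) (eps_iota ch) (eps_iota ck).
by rewrite (eps_iota (@continuous_lin R _ c h k ch ck)).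
Qed.

Lemma epsM a b : C a -> C b -> eps (a * b) = eps a * eps b.
Proof.
move=> /group_algebraP[h ch <-] /group_algebraP[k ck <-].
rewrite -(ident_mul iotaP ch ck) (eps_iota ch) (eps_iota ck).
by rewrite (eps_iota (continuous_mul ch ck)).
Qed.

Lemma eps_star a : C a -> eps (star a) = Num.conj (eps a).
Proof.
move=> /group_algebraP[h ch <-].
rewrite -(ident_star iotaP ch) (eps_iota ch).
by rewrite (eps_iota (continuous_conj ch)).
Qed.

Lemma eps_u g : eps (u g) = 1.
Proof. by rewrite -(ident_eval iotaP) eps_iota //; exact: continuous_eval. Qed.

Lemma eps1 : eps 1 = 1.
Proof. by rewrite -u0 eps_u. Qed.

(** On self-adjoint elements the functional takes real values, where the
    inequality r^2 <= r^2 + s^2 is clear. *)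
Lemma eps_bounded a : C a -> rnorm (eps a) <= 2 * rnorm a.
Proof.
have [_ C0 Cl CM Cs] := group_algebra_subalgebra.
have e0 : eps 0 = 0.
  have := eps_lin 1 C0 C0; rewrite scale1r addr0 mul1r => /eqP.
  by rewrite -subr_eq0 opprD addNKr oppr_eq0 => /eqP.
apply: (@seminorm_bounded R A C (fun x => rnorm (eps x))).
- exact: group_algebra_subalgebra.
- exact: group_algebra1.
- by move=> x; exact: rnorm_ge0.
- move=> t x Cx t0; rewrite -[t%:C *: x]addr0 eps_lin // e0 addr0.
  by rewrite rnorm_scalarM rnorm_real ger0_norm.
- move=> x Cx; rewrite epsM ?eps_star //; last exact: Cs.
  by rewrite rnorm_scalarM expr2 {1}/rnorm norm_conjC.
- move=> x y Cx Cy sx sy xy xxyy.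
  have real z : C z -> star z = z -> exists r : R, eps z = r%:C.
    by move=> Cz sz; apply/complex_realP/CrealP; rewrite -eps_star // sz.
  have [r er] := real x Cx sx; have [s es] := real y Cy sy.
  have : (r * r + s * s)%:C = 1.
    rewrite rmorphD !rmorphM /= -er -es -!epsM // -eps1 -xxyy.
    by have := eps_lin 1 (CM _ _ Cx Cx) (CM _ _ Cy Cy); rewrite scale1r mul1r.
  move=> /(@complexI R) => rs.
  by rewrite er rnorm_real -(@expr_le1 _ 2) // real_normK ?num_real // expr2; nra.
Qed.

End TrivialCharacter.

(** * Monomials and scalars in the crossed product *)

Section Relations.
Context {R : realType} {G : zmodType} (theta : {additive G -> G}).
Hypothesis theta_exact :
  \bigcap_(n in [set: nat]) range (iter n theta) = [set 0].
Variables (A : cstarAlgType R) (u : G -> A) (s : A).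
Hypothesis rel : defining_relations theta u s.
Implicit Types (x y : A) (g h a b : G) (n m p q d : nat).

Lemma iter_thetaN n g : iter n theta (- g) = - iter n theta g.
Proof. by elim: n => //= n ->; rewrite raddfN. Qed.

(** A periodic point of theta lies in the image of every iterate of theta. *)
Lemma not_fixed g d : g <> 0 -> (0 < d)%N -> iter d theta g <> g.
Proof.
move=> g0 d0 fix_g; apply: g0.
suff : (\bigcap_(n in [set: nat]) range (iter n theta)) g by rewrite theta_exact.
move=> n _.
have E k : iter (k * d) theta g = g.
  by elim: k => // k IH; rewrite mulSn iterD IH fix_g.
exists (iter (n * d - n) theta g) => //.
by rewrite -iterD subnKC ?E // leq_pmulr.
Qed.

Lemma u_mul g h : u g * u h = u (g + h).
Proof. by rewrite (rel_mul rel). Qed.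

Lemma u_zero : u 0 = 1.
Proof.
have [h _] := rel_unitary rel 0.
by rewrite -[LHS]mul1r -{1}h -mulrA u_mul addr0 h.
Qed.

Lemma u_opp g : u g * u (- g) = 1.
Proof. by rewrite u_mul subrr u_zero. Qed.

Lemma u_star g : star (u g) = u (- g).
Proof.
have [h _] := rel_unitary rel g.
by rewrite -[LHS]mulr1 -(u_opp g) mulrA h mul1r.
Qed.

Lemma rnorm_u g : rnorm (u g) = 1.
Proof. exact/rnorm_unitary/(rel_unitary rel). Qed.

Lemma s_u n g : s ^+ n * u g = u (iter n theta g) * s ^+ n.
Proof.
elim: n => [|n IH]; first by rewrite !expr0 mul1r mulr1.
by rewrite exprS -mulrA IH mulrA (rel_intertwine rel) -mulrA.
Qed.

Lemma star_exp x n : star (x ^+ n) = star x ^+ n.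
Proof.
elim: n => [|n IH]; first by rewrite !expr0 star1.
by rewrite exprS star_mul IH exprSr.
Qed.

Lemma u_sstar n g : u g * star s ^+ n = star s ^+ n * u (iter n theta g).
Proof.
have := congr1 star (s_u n (- g)).
by rewrite !star_mul !u_star star_exp iter_thetaN !opprK.
Qed.

Lemma sstar_s n : star s ^+ n * s ^+ n = 1.
Proof.
elim: n => [|n IH]; first by rewrite !expr0 mul1r.
by rewrite exprSr exprS mulrA -[_ * star s * s]mulrA (rel_isometry rel) mulr1.
Qed.

Lemma rnorm_s n : rnorm (s ^+ n) = 1.
Proof. by apply: rnorm_isometry; rewrite star_exp sstar_s. Qed.

Lemma rnorm_sstar n : rnorm (star s ^+ n) = 1.
Proof. by rewrite -star_exp rnorm_star rnorm_s. Qed.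

(** The transfer operator x |-> s^* x s, iterated n times. On the group algebra
    it converges to the canonical trace, since it eventually kills u_g for
    g <> 0. *)
Definition shrink n x := star s ^+ n * x * s ^+ n.

Lemma shrink_blin n : bounded_linear (shrink n).
Proof. exact: blin_mul2. Qed.

Lemma shrink_shrink n m x : shrink n (shrink m x) = shrink (m + n) x.
Proof. by rewrite /shrink [in star s ^+ (m + n)]addnC !exprD !mulrA. Qed.

Lemma rnorm_shrink n x : rnorm (shrink n x) <= rnorm x.
Proof.
have := rnormM (star s ^+ n * x) (s ^+ n); have := rnormM (star s ^+ n) x.
by rewrite rnorm_s rnorm_sstar mul1r mulr1 => h1 h2; apply: le_trans h2 h1.
Qed.

Lemma shrink1 n : shrink n 1 = 1.
Proof. by rewrite /shrink mulr1 sstar_s. Qed.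

Lemma shrink_zero n : shrink n 0 = 0.
Proof. by rewrite /shrink mulr0 mul0r. Qed.

Lemma shrink_u_range n g : shrink n (u (iter n theta g)) = u g.
Proof. by rewrite /shrink -u_sstar -mulrA sstar_s mulr1. Qed.

Lemma shrink_u_out n g : ~ range (iter n theta) g -> shrink n (u g) = 0.
Proof.
elim: n g => [g []|n IH g out]; first by exists g.
rewrite -add1n -shrink_shrink.
have [[g' _ gg']|gout] := pselect (range theta g); last first.
  by rewrite {2}/shrink !expr1 (rel_orthogonal rel gout) shrink_zero.
rewrite -gg' (shrink_u_range 1) IH // => -[h _ hg']; apply: out.
by exists h; rewrite //= hg'.
Qed.

Lemma shrink_u_vanish g : g <> 0 ->
  exists n0, forall n, (n0 <= n)%N -> shrink n (u g) = 0.
Proof.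
move=> g0; have [n0 out] : exists n0, ~ range (iter n0 theta) g.
  apply/existsNP => h; apply: g0.
  suff : (\bigcap_(n in [set: nat]) range (iter n theta)) g by rewrite theta_exact.
  by move=> n _; exact: h.
exists n0 => n /subnKC <-.
by rewrite -shrink_shrink shrink_u_out ?shrink_zero.
Qed.

(** Compression by a high power of s maps 1 - u_g to 1. *)
Lemma rnorm_u_sub1 g : g <> 0 -> 1 <= rnorm (1 - u g).
Proof.
move=> /shrink_u_vanish[n /(_ n (leqnn _)) h].
have := rnorm_shrink n (1 - u g).
by rewrite (blinB (shrink_blin n)) h shrink1 subr0 rnorm_one.
Qed.

Definition monomial (t : G * nat * nat * G) : A :=
  let: (a, p, q, b) := t in u a * s ^+ p * star s ^+ q * u b.

Lemma sstar_u_s g : star s * u g * s = 0 \/ exists h, star s * u g * s = u h.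
Proof.
have [[h _ <-]|out] := pselect (range theta g).
  by right; exists h; have := shrink_u_range 1 h; rewrite /shrink !expr1.
by left; exact: (rel_orthogonal rel).
Qed.

Lemma monomial_induction : cstar_generated (range u `|` [set s]) = [set: A] ->
  forall P, closed_subspace P -> (forall t, P (monomial t)) -> forall x, P x.
Proof.
move=> gen P Psub Pmon x.
have : cstar_generated (range u `|` [set s]) x by rewrite gen.
move: P Psub Pmon x.
suff H : forall P, closed_subspace P -> range monomial `<=` P ->
    cstar_generated (range u `|` [set s]) `<=` P.
  by move=> P Psub Pmon x; apply: H => // _ [t _ <-].
have mul_u h t : range monomial (u h * monomial t).
  case: t => [[[a p] q] b]; exists (h + a, p, q, b) => //=.
  by rewrite -u_mul !mulrA.
apply: generated_induction.
- by exists (0, 0%N, 0%N, 0) => //=; rewrite u_zero !expr0 !mulr1.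
- move=> _ _ [[h _ <-]|->] [t _ <-]; right; first exact: mul_u.
  case: t => [[[a p] q] b]; exists (theta a, p.+1, q, b) => //=.
  by rewrite !mulrA (rel_intertwine rel) exprS !mulrA.
- move=> _ _ [[h _ <-]|->] [t _ <-]; first by rewrite u_star; right; exact: mul_u.
  case: t => [[[a [|p]] q] b] /=.
    right; exists (0, 0%N, q.+1, iter q theta a + b) => //=.
    rewrite u_zero !expr0 !mul1r !mulr1 -u_mul exprS !mulrA; congr (_ * _).
    by rewrite -!mulrA u_sstar.
  rewrite exprS !mulrA; have [->|[h ->]] := sstar_u_s a; first by left; rewrite !mul0r.
  by right; exists (h, p, q, b).
Qed.

Definition comb (r : seq (R[i] * (G * nat * nat * G))) : A :=
  \sum_(t <- r) t.1 *: monomial t.2.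

Lemma comb_dense : cstar_generated (range u `|` [set s]) = [set: A] ->
  forall x (e : R), 0 < e -> exists r, rnorm (x - comb r) < e.
Proof.
move=> gen; apply: (monomial_induction gen); first split.
- apply/closed_rnormP => x hx e e0; have e2 : 0 < e / 2 by lra.
  have [y /(_ _ e2)[r hr] xy] := hx _ e2; exists r.
  by have := rnormD (x - y) (y - comb r); rewrite addrA subrK; lra.
- by move=> e e0; exists [::]; rewrite /comb big_nil subrr rnorm0.
- move=> a x y hx hy e e0.
  (* rnorm a + 1 rather than rnorm a, as a may be 0 *)
  have a1 : 0 < rnorm a + 1 by have := rnorm_ge0 a; lra.
  have e2 : 0 < e / 2 by lra.
  have [r hr] := hx (e / 2 / (rnorm a + 1)) (divr_gt0 e2 a1).
  have [r' hr'] := hy _ e2.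
  exists ([seq (a * t.1, t.2) | t <- r] ++ r').
  have -> : a *: x + y - comb ([seq (a * t.1, t.2) | t <- r] ++ r')
      = a *: (x - comb r) + (y - comb r').
    rewrite /comb big_cat big_map /= opprD addrACA scalerBr scaler_sumr.
    by congr (_ - _ + _); apply: eq_bigr => t _; rewrite scalerA.
  apply: le_lt_trans (rnormD _ _) _; rewrite rnormZ.
  move: hr; rewrite ltr_pdivlMr // => hr.
  have := rnorm_ge0 (x - comb r); nra.
- move=> t e e0; exists [:: (1, t)].
  by rewrite /comb big_seq1 scale1r subrr rnorm0.
Qed.

(** Each compression by s lowers both exponents of a monomial, until one of
    them is 0; the group elements then merge and are either trivial or
    eventually killed. *)
Lemma shrink_mon_eventually p q a b : exists n v,
  [\/ v = 0, exists d, v = s ^+ d | exists d, v = star s ^+ d]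
  /\ shrink n (monomial (a, p, q, b)) = v.
Proof.
have base_u g : exists n v, (v = 0 \/ v = 1) /\ shrink n (u g) = v.
  have [->|/eqP/shrink_u_vanish[n /(_ n (leqnn _)) h]] := eqVneq g 0.
    by exists 0%N, 1; rewrite u_zero shrink1; split; [right|].
  by exists n, 0; split; [left|].
elim: p q a b => [|p IH] q a b.
  have [n [v [hv E]]] := base_u (iter q theta a + b).
  exists n, (star s ^+ q * v); split.
    case: hv => ->; first by constructor 1; rewrite mulr0.
    by constructor 3; exists q; rewrite mulr1.
  rewrite -E /= expr0 mulr1 u_sstar -mulrA u_mul /shrink !mulrA -!exprD.
  by rewrite addnC.
case: q => [|q].
  have [n [v [hv E]]] := base_u (a + iter p.+1 theta b).
  exists n, (v * s ^+ p.+1); split.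
    case: hv => ->; first by constructor 1; rewrite mul0r.
    by constructor 2; exists p.+1; rewrite mul1r.
  rewrite -E /monomial expr0 mulr1 -mulrA s_u mulrA u_mul /shrink -!mulrA -!exprD.
  by rewrite addnC.
have E : shrink 1 (monomial (a, p.+1, q.+1, b)) =
    (star s * u a * s) * s ^+ p * star s ^+ q * (star s * u b * s).
  by rewrite /shrink /= !expr1 exprS exprSr !mulrA.
have [Ea|[a' Ea]] := sstar_u_s a.
  exists 1%N, 0; split; first by constructor 1.
  by rewrite E Ea !mul0r.
have [Eb|[b' Eb]] := sstar_u_s b.
  exists 1%N, 0; split; first by constructor 1.
  by rewrite E Eb !mulr0.
have [n [v [hv Ev]]] := IH q a' b'; exists (1 + n)%N, v; split => //.
by rewrite -shrink_shrink E Ea Eb.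
Qed.

(** A contraction that fixes every element commuting with all u_h and s. The
    inner compressions turn a monomial into 0 or a power of s or s^*, and
    conjugation by u_g together with the outer compressions kills all such
    powers except 1. *)
Definition squeeze g n x := shrink n (u g * shrink n x * u (- g)).

Lemma squeeze_blin g n : bounded_linear (squeeze g n).
Proof.
by apply: (blin_comp (shrink_blin n)); apply: (blin_comp (blin_mul2 _ _) (shrink_blin n)).
Qed.

Lemma rnorm_conj g x : rnorm (u g * x * u (- g)) <= rnorm x.
Proof.
have := rnormM (u g * x) (u (- g)); have := rnormM (u g) x.
by rewrite !rnorm_u mul1r mulr1 => h1 h2; apply: le_trans h2 h1.
Qed.

Lemma rnorm_squeeze g n x : rnorm (squeeze g n x) <= rnorm x.
Proof.
by apply: le_trans (rnorm_shrink _ _) _; apply: le_trans (rnorm_conj _ _) _; exact: rnorm_shrink.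
Qed.

Lemma shrink_s n d : shrink n (s ^+ d) = s ^+ d.
Proof. by rewrite /shrink -mulrA -exprD addnC exprD mulrA sstar_s mul1r. Qed.

Lemma shrink_sstar n d : shrink n (star s ^+ d) = star s ^+ d.
Proof. by rewrite /shrink -exprD addnC exprD -mulrA sstar_s mulr1. Qed.

Lemma squeeze_monomial g t : g <> 0 -> exists (c : R[i]) n0,
  forall n, (n0 <= n)%N -> squeeze g n (monomial t) = c *: 1.
Proof.
move=> g0; case: t => [[[a p] q] b].
have [m [v [hv E]]] := shrink_mon_eventually p q a b.
have Ev n : (m <= n)%N -> shrink n (monomial (a, p, q, b)) = v.
  move=> /subnKC <-; rewrite -shrink_shrink E.
  by case: hv => [->|[d ->]|[d ->]]; rewrite ?shrink_zero ?shrink_s ?shrink_sstar.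
case: hv => [v0|[d vd]|[d vd]].
- exists 0, m => n /Ev; rewrite /squeeze => ->.
  by rewrite v0 mulr0 mul0r shrink_zero scale0r.
- have E' n : (m <= n)%N -> squeeze g n (monomial (a, p, q, b))
      = shrink n (u (g - iter d theta g)) * s ^+ d.
    move=> /Ev; rewrite /squeeze => ->; rewrite vd -mulrA s_u mulrA u_mul iter_thetaN.
    by rewrite /shrink -!mulrA -!exprD addnC.
  case: d E' {vd} => [|d] E'.
    exists 1, m => n /E' ->.
    by rewrite /= subrr u_zero shrink1 mulr1 scale1r.
  have /shrink_u_vanish[k hk] : g - iter d.+1 theta g <> 0.
    by move/eqP; rewrite subr_eq0 eq_sym => /eqP; exact: not_fixed.
  exists 0, (maxn m k) => n; rewrite geq_max => /andP[/E' -> /hk ->].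
  by rewrite mul0r scale0r.
- have E' n : (m <= n)%N -> squeeze g n (monomial (a, p, q, b))
      = star s ^+ d * shrink n (u (iter d theta g - g)).
    move=> /Ev; rewrite /squeeze => ->; rewrite vd u_sstar -mulrA u_mul.
    by rewrite /shrink !mulrA -!exprD addnC.
  case: d E' {vd} => [|d] E'.
    exists 1, m => n /E' ->.
    by rewrite /= subrr u_zero shrink1 mulr1 scale1r.
  have /shrink_u_vanish[k hk] : iter d.+1 theta g - g <> 0.
    by move/eqP; rewrite subr_eq0 => /eqP; exact: not_fixed.
  exists 0, (maxn m k) => n; rewrite geq_max => /andP[/E' -> /hk ->].
  by rewrite mulr0 scale0r.
Qed.

Lemma squeeze_scalar : cstar_generated (range u `|` [set s]) = [set: A] ->
  forall g, g <> 0 -> forall x (e : R), 0 < e -> exists (c : R[i]) n0,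
  forall n, (n0 <= n)%N -> rnorm (squeeze g n x - c *: 1) < e.
Proof.
move=> gen g g0; apply: (monomial_induction gen); first split.
- apply/closed_rnormP => x hx e e0; have e2 : 0 < e / 2 by lra.
  have [y /(_ _ e2)[c [n0 hc]] xy] := hx _ e2; exists c, n0 => n /hc h.
  have := rnormD (squeeze g n (x - y)) (squeeze g n y - c *: 1).
  rewrite addrA (blinB (squeeze_blin g n)) subrK -(blinB (squeeze_blin g n)).
  have := rnorm_squeeze g n (x - y); lra.
- move=> e e0; exists 0, 0%N => n _.
  by rewrite (blin0 (squeeze_blin g n)) scale0r subrr rnorm0.
- move=> a x y hx hy e e0.
  have a1 : 0 < rnorm a + 1 by have := rnorm_ge0 a; lra.
  have e2 : 0 < e / 2 by lra.
  have [c [n0 hc]] := hx (e / 2 / (rnorm a + 1)) (divr_gt0 e2 a1).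
  have [c' [n1 hc']] := hy _ e2.
  exists (a * c + c'), (maxn n0 n1) => n; rewrite geq_max => /andP[/hc h /hc' h'].
  rewrite (blinD (squeeze_blin g n)) (blinZ (squeeze_blin g n)).
  rewrite scalerDl opprD addrACA -scalerA -scalerBr.
  apply: le_lt_trans (rnormD _ _) _; rewrite rnormZ.
  move: h; rewrite ltr_pdivlMr // => h.
  have := rnorm_ge0 (squeeze g n x - c *: 1); nra.
- move=> t e e0; have [c [n0 h]] := squeeze_monomial t g0.
  by exists c, n0 => n /h ->; rewrite subrr rnorm0.
Qed.

(** The maps [squeeze g n] fix x, and in the limit they send everything to
    scalars; so the centre of the algebra is trivial. *)
Lemma central_near_scalar : cstar_generated (range u `|` [set s]) = [set: A] ->
  forall g, g <> 0 -> forall x, (forall g, u g * x = x * u g) -> s * x = x * s ->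
  forall e : R, 0 < e -> exists c : R[i], rnorm (x - c *: 1) < e.
Proof.
move=> gen g g0 x xu xs e e0.
have [c [n0 /(_ n0 (leqnn _))]] := squeeze_scalar gen g0 x e0.
have sx n : s ^+ n * x = x * s ^+ n.
  elim: n => [|n IH]; first by rewrite expr0 mul1r mulr1.
  by rewrite exprS -mulrA IH mulrA xs mulrA.
have shx n : shrink n x = x by rewrite /shrink -mulrA -sx mulrA sstar_s mul1r.
by rewrite /squeeze shx xu -mulrA u_opp mulr1 shx => h; exists c.
Qed.

End Relations.

(** * Averages over cosets *)

Section Averages.
Context {R : realType} {G : zmodType} (theta : {additive G -> G}).
Hypothesis theta_coker : finite_set (cokernel theta).
Variables (A : cstarAlgType R) (u : G -> A) (s : A).
Hypothesis rel : defining_relations theta u s.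
Implicit Types (x y : A) (g h a b : G) (n m p q d : nat).

Let cosets : seq (set G) := finmap.enum_fset (fset_set (cokernel theta)).
Let rep (c : set G) : G := xget 0 c.

Lemma sum_cosets :
  \sum_(c <- cosets) u (rep c) * s * star s * u (- rep c) = 1.
Proof.
rewrite -(rel_sum rel) fsbig_finite //; apply: eq_bigr => c _.
by rewrite (u_star rel).
Qed.

Let N : R := (size cosets)%:R.

Lemma cosets_neq0 : 0 < N.
Proof.
rewrite ltr0n lt0n; apply/negP => /nilP h; have := sum_cosets.
by rewrite h big_nil => /eqP; rewrite eq_sym oner_eq0.
Qed.

(** For x = s^(j+1) s^*(j+1), the relation that the range projections of the
    u_c s add up to 1 turns the average into s^j s^*j / N. *)
Definition coset_average j x : A :=
  (N^-1)%:C *: \sum_(c <- cosets)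
    u (iter j theta (rep c)) * x * u (- iter j theta (rep c)).

Lemma coset_average_blin j : bounded_linear (coset_average j).
Proof. by apply: blin_scale; apply: blin_bigsum => c; exact: blin_mul2. Qed.

Lemma sum_constant (x : A) : (N^-1)%:C *: \sum_(c <- cosets) x = x.
Proof.
have N0 := cosets_neq0.
rewrite big_const_seq count_predT iter_addr_0 -scaler_nat scalerA.
have -> : ((size cosets)%:R : R[i]) = N%:C by rewrite rmorph_nat.
by rewrite -rmorphM /= mulVf ?scale1r // gt_eqF.
Qed.

Lemma rnorm_coset_average j x : rnorm (coset_average j x) <= rnorm x.
Proof.
have N0 := cosets_neq0.
rewrite rnormZ rnorm_real gtr0_norm ?invr_gt0 // ler_pdivrMl // /N.
elim: cosets => [|c r IH]; first by rewrite big_nil rnorm0 mul0r.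
rewrite big_cons /= -addn1 natrD mulrDl mul1r addrC.
apply: le_trans (rnormD _ _) _; apply: lerD => //; exact: (rnorm_conj rel).
Qed.

Lemma coset_average_fix j x :
  (forall g, u g * x = x * u g) -> coset_average j x = x.
Proof.
move=> xu; rewrite -[RHS]sum_constant; congr (_ *: _); apply: eq_bigr => c _.
by rewrite xu -mulrA (u_opp rel) mulr1.
Qed.

Lemma coset_average_bimodule j a b x :
  coset_average j (u a * x * u b) = u a * coset_average j x * u b.
Proof.
rewrite -scalerAr -scalerAl mulr_sumr mulr_suml; congr (_ *: _).
apply: eq_bigr => c _; set g := iter _ _ _.
rewrite !mulrA (u_mul rel) addrC -(u_mul rel) -!mulrA; congr (_ * (_ * (_ * _))).
by rewrite !(u_mul rel) addrC.
Qed.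

Lemma coset_average_fixed j p : (p <= j)%N ->
  coset_average j (s ^+ p * star s ^+ p) = s ^+ p * star s ^+ p.
Proof.
move=> pj; rewrite -[RHS]sum_constant; congr (_ *: _); apply: eq_bigr => c _.
rewrite -(subnKC pj) iterD -iter_thetaN !mulrA -(s_u rel) -mulrA -(u_sstar rel).
by rewrite -mulrA [u _ * (_ * _)]mulrA (u_opp rel) mul1r.
Qed.

Lemma coset_average_step j :
  coset_average j (s ^+ j.+1 * star s ^+ j.+1)
  = (N^-1)%:C *: (s ^+ j * star s ^+ j).
Proof.
congr (_ *: _); transitivity (s ^+ j * 1 * star s ^+ j); last by rewrite mulr1.
rewrite -sum_cosets mulr_sumr mulr_suml; apply: eq_bigr => c _.
rewrite exprSr exprS -iter_thetaN !mulrA -(s_u rel) -!mulrA; do 4! congr (_ * _).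
by rewrite (u_sstar rel).
Qed.

(** The levels are treated from the top one downwards, so that s^p s^*p loses
    one power of s and s^* at each level below p and ends up a scalar. *)
Fixpoint averages k x : A :=
  if k is k'.+1 then averages k' (coset_average k' x) else x.

Lemma averages_blin k : bounded_linear (averages k).
Proof.
elim: k => [|k IH] /=; first exact: blin_id.
exact: blin_comp IH (coset_average_blin k).
Qed.

Lemma rnorm_averages k x : rnorm (averages k x) <= rnorm x.
Proof.
elim: k x => //= k IH x; apply: le_trans (IH _) _; exact: rnorm_coset_average.
Qed.

Lemma averages_fix k x : (forall g, u g * x = x * u g) -> averages k x = x.
Proof. by move=> xu; elim: k => //= k IH; rewrite coset_average_fix. Qed.

Lemma averages_bimodule k a b x :
  averages k (u a * x * u b) = u a * averages k x * u b.
Proof. by elim: k x => //= k IH x; rewrite coset_average_bimodule IH. Qed.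

Lemma averages_scalar k p : (p <= k)%N ->
  exists c : R[i], averages k (s ^+ p * star s ^+ p) = c *: 1.
Proof.
elim: k p => [|k IH] p.
  by rewrite leqn0 => /eqP ->; exists 1; rewrite /= !expr0 mulr1 scale1r.
rewrite leq_eqVlt => /orP[/eqP ->|pk] /=.
  have [c Ec] := IH k (leqnn _); exists ((N^-1)%:C * c).
  by rewrite coset_average_step (blinZ (averages_blin k)) Ec scalerA.
by rewrite coset_average_fixed //; exact: IH.
Qed.

Lemma averages_monomial k a p b : (p <= k)%N ->
  group_algebra u (averages k (monomial u s (a, p, p, b))).
Proof.
move=> pk; rewrite /= -[_ * _ * star s ^+ p]mulrA averages_bimodule.
have [c ->] := averages_scalar pk.
have [_ C0 Cl _ _] := group_algebra_subalgebra u.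
rewrite -scalerAr mulr1 -scalerAl (u_mul rel) -[_ *: _]addr0; apply: Cl => //.
exact: group_algebra_u.
Qed.

(** On the group algebra this is the endomorphism induced by theta; in terms of
    functions on the dual group it is the composition with the dual map of
    theta, which fixes the trivial character. *)
Definition shift_endo x : A :=
  \sum_(c <- cosets) u (rep c) * s * x * star s * u (- rep c).

Lemma shift_endo_blin : bounded_linear shift_endo.
Proof.
apply: blin_bigsum => c.
exact: blin_comp (blin_mulr _) (blin_comp (blin_mulr _) (blin_mull _)).
Qed.

Lemma shift_endo_u g : shift_endo (u g) = u (theta g).
Proof.
rewrite -[RHS]mulr1 -sum_cosets mulr_sumr; apply: eq_bigr => c _.
rewrite -[_ * s * u g]mulrA (rel_intertwine rel) !mulrA; do 3! congr (_ * _).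
by rewrite !(u_mul rel) addrC.
Qed.

(** Inserting 1, as the sum of the range projections of the u_c s, to the right
    of w, and moving w through u_c s. *)
Lemma shift_endo_intertwine w F : (forall g, u g * w = w * u g) ->
  (forall g, u g * F = F * u g) -> w * s = F * s * w -> w = F * shift_endo w.
Proof.
move=> wu Fu ws; rewrite -[LHS]mulr1 -sum_cosets !mulr_sumr; apply: eq_bigr => c _.
rewrite !mulrA -wu -[u _ * w * s]mulrA ws !mulrA; do 4! congr (_ * _).
by rewrite Fu.
Qed.

End Averages.

(** * Gauge automorphisms and homogeneous approximation *)

Section Homogeneous.
Context {R : realType} {G : zmodType} (theta : {additive G -> G}).
Variables (A : cstarAlgType R) (u : G -> A) (s : A).
Hypothesis rel : defining_relations theta u s.
Hypothesis gen : cstar_generated (range u `|` [set s]) = [set: A].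

Definition gauge (z : R[i]) (gam : A -> A) : Prop :=
  [/\ star_morphism gam, forall g, gam (u g) = u g & gam s = z *: s].

Lemma morphX (gam : A -> A) x n : star_morphism gam -> gam (x ^+ n) = gam x ^+ n.
Proof.
move=> gm; elim: n => [|n IH]; first by rewrite !expr0 (morph1 gm).
by rewrite !exprS (morphM gm) IH.
Qed.

Lemma gauge_monomial z gam a p q b : gauge z gam ->
  gam (monomial u s (a, p, q, b))
  = (z ^+ p * Num.conj z ^+ q) *: monomial u s (a, p, q, b).
Proof.
move=> [gm gu gs] /=; rewrite !(morphM gm) !gu !(morphX _ _ gm) (morph_star gm) gs starZ.
by rewrite !exprZn -!scalerAr -!scalerAl scalerA mulrC.
Qed.

(** A 2^n-th root of -1 has order exactly 2^(n+1). *)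
Lemma primitive_root_exists (n : nat) : exists2 M, (n < M)%N &
  exists2 z : R[i], M.-primitive_root z & Num.conj z * z = 1.
Proof.
pose z : R[i] := (2 ^ n).-root (-1).
have zn : z ^+ (2 ^ n) = -1 by apply: rootCK; rewrite expn_gt0.
exists (2 ^ n.+1)%N; first by apply: ltn_trans (ltn_expl _ _) => //.
exists z.
  have z2 : z ^+ (2 ^ n.+1) = 1 by rewrite expnSr exprM zn sqrrN expr1n.
  have [m zm] := prim_order_exists (expn_gt0 2 n.+1) z2.
  move=> /(dvdn_pfactor _ _ (isT : prime 2))[k kn mE].
  move: kn; rewrite leq_eqVlt => /orP[/eqP <-|]; first by rewrite -mE.
  rewrite ltnS => kn; have : z ^+ (2 ^ n) = 1.
    by apply/eqP; rewrite -(prim_order_dvd zm) mE dvdn_exp2l.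
  rewrite zn => /eqP; rewrite -subr_eq0 -opprD oppr_eq0 -mulr2n.
  by rewrite pnatr_eq0.
have z1 : `|z| = 1.
  apply/eqP; rewrite -(@pexpr_eq1 _ _ (2 ^ n)) ?expn_gt0 //.
  by rewrite -normrX zn normrN1.
by rewrite mulrC -normCK z1 expr1n.
Qed.

Definition of_degree (p0 q0 : nat) (t : R[i] * (G * nat * nat * G)) : bool :=
  let: (_, (_, p, q, _)) := t in (p + q0 == p0 + q)%N.

(** A combination of monomials r close to w involves only degrees smaller in
    absolute value than M/2, for some M. For a primitive M-th root of unity z,
    the gauge morphism of z has the identity as its M-th iterate and w as an
    eigenvector, so averaging its iterates against the powers of the inverse
    eigenvalue fixes w and kills all degrees but one modulo M. By the choice of
    M at most one degree of r is left. The averages are bounded by 2 whatever M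
    is. *)
Lemma homogeneous_approximation w : w <> 0 ->
  (forall z, Num.conj z * z = 1 -> exists2 gam, gauge z gam &
    exists c, gam w = c *: w) ->
  forall e : R, 0 < e -> exists r p0 q0,
    all (of_degree p0 q0) r /\ rnorm (w - comb u s r) < e.
Proof.
move=> w0 wgauge e e0.
have e2 : 0 < e / 2 by lra.
have [r hr] := comb_dense rel gen w e2.
pose deg (t : R[i] * (G * nat * nat * G)) := let: (_, (_, p, q, _)) := t in (p + q)%N.
have [M hM [z zM zz]] := primitive_root_exists (2 * \sum_(t <- r) deg t).
have [gam gP [c gw]] := wgauge z zz.
have M0 : (0 < M)%N := leq_ltn_trans (leq0n _) hM.
have MR : (0 : R) < M%:R by rewrite ltr0n.
have zMM : z ^+ M = 1 := prim_expr_order zM.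
case: (gP) => gm _ _.
have iterg k : bounded_linear (iter k gam).
  elim: k => [|k IH]; first exact: blin_id.
  exact: blin_comp (star_morphism_blin gm) IH.
have itermorph k : star_morphism (iter k gam).
  split; first by case: (iterg k).
    elim: k => [|k [h1 hM']]; first by [].
    by split => [|x y] /=; rewrite ?h1 ?hM' ?(morph1 gm) ?(morphM gm).
  by elim: k => // k IH x; rewrite !iterS IH (morph_star gm).
have iterw k : iter k gam w = c ^+ k *: w.
  elim: k => [|k IH]; first by rewrite expr0 scale1r.
  by rewrite iterS IH (morphZ gm) gw scalerA exprSr.
have itermon k a p q b : iter k gam (monomial u s (a, p, q, b))
    = (z ^+ p * Num.conj z ^+ q) ^+ k *: monomial u s (a, p, q, b).
  elim: k => [|k IH]; first by rewrite expr0 scale1r.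
  by rewrite iterS IH (morphZ gm) (gauge_monomial _ _ _ _ gP) scalerA exprSr.
have cM : c ^+ M = 1.
  have idM x : iter M gam x = x.
    apply: (monomial_induction rel gen (closed_subspace_eq (iterg M) (@blin_id _ _))).
    move=> [[[a p] q] b]; rewrite /= -/(monomial u s (a, p, q, b)) itermon.
    rewrite exprMn -!exprM ![(_ * M)%N]mulnC !exprM -rmorphXn /= zMM rmorph1.
    by rewrite !expr1n mulr1 scale1r.
  have /eqP := iterw M; rewrite idM eq_sym -subr_eq0 -[X in _ - X]scale1r -scalerBl.
  by rewrite scaler_eq0 subr_eq0 => /orP[/eqP //|/eqP/w0].
have c0 : c != 0 by apply: contra_eq_neq cM => ->; rewrite expr0n gtn_eqF // eq_sym oner_eq0.
have nc : rnorm c = 1.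
  have := congr1 rnorm cM; rewrite rnorm1 => E; apply/eqP.
  rewrite -(@pexpr_eq1 _ _ M) ?rnorm_ge0 // -E; apply/eqP.
  by elim: (M) => [|k IH]; rewrite ?expr0 ?rnorm1 // !exprS rnorm_scalarM IH.
have ncV k : rnorm (c ^- k) = 1.
  have ck : c ^- k * c ^+ k = 1 by rewrite mulVf // expf_neq0.
  have nck : rnorm (c ^+ k) = 1.
    by elim: (k) => [|i IH]; rewrite ?expr0 ?rnorm1 // exprS rnorm_scalarM IH nc mul1r.
  by have := congr1 rnorm ck; rewrite rnorm_scalarM nck rnorm1 mulr1.
(* the spectral projection of gam for the eigenvalue c *)
pose proj x : A := (M%:R^-1) *: \sum_(k < M) c ^- k *: iter k gam x.
have proj_lin : bounded_linear proj.
  by apply: blin_scale; apply: blin_bigsum => k; exact: blin_scale.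
have M0' : (M%:R : R[i]) != 0 by rewrite pnatr_eq0 -lt0n.
have projw : proj w = w.
  rewrite /proj (eq_bigr (fun=> w)) => [|k _]; last first.
    by rewrite iterw scalerA mulVf ?scale1r // expf_neq0.
  by rewrite sumr_const card_ord -[w *+ M]scaler_nat scalerA mulVf ?scale1r.
have rnorm_proj x : rnorm (proj x) <= 2 * rnorm x.
  rewrite /proj rnormZ; have -> : (M%:R^-1 : R[i]) = (M%:R^-1)%:C.
    by rewrite fmorphV rmorph_nat.
  rewrite rnorm_real gtr0_norm ?invr_gt0 // ler_pdivrMl //.
  have -> : M%:R * (2 * rnorm x) = \sum_(k < M) 2 * rnorm x.
    by rewrite sumr_const card_ord mulr_natl.
  apply: (big_rec2 (fun (a : A) (b : R) => rnorm a <= b)); first by rewrite rnorm0.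
  move=> k a b _ ab; apply: le_trans (rnormD _ _) _; apply: lerD => //.
  by rewrite rnormZ ncV mul1r; exact: star_morphism_bounded.
pose good (t : R[i] * (G * nat * nat * G)) := let: (_, (_, p, q, _)) := t in z ^+ p == c * z ^+ q.
have z0 : z != 0 by apply: contra_eq_neq zz => ->; rewrite mulr0 eq_sym oner_eq0.
have projmon t : proj (monomial u s t.2) = if good t then monomial u s t.2 else 0.
  case: t => [l [[[a p] q] b]]; rewrite [good _]/= [_.2]/=.
  pose rho := c^-1 * (z ^+ p * Num.conj z ^+ q).
  have -> : proj (monomial u s (a, p, q, b))
      = (M%:R^-1 * \sum_(k < M) rho ^+ k) *: monomial u s (a, p, q, b).
    rewrite /proj -scalerA scaler_suml; congr (_ *: _); apply: eq_bigr => k _.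
    by rewrite itermon scalerA /rho [in RHS]exprMn exprVn.
  have rhoE : rho = c^-1 * (z ^+ p / z ^+ q).
    by rewrite /rho -exprVn; congr (_ * (_ * _ ^+ _)); apply: (mulIf z0); rewrite zz mulVf.
  have -> : (z ^+ p == c * z ^+ q) = (rho == 1).
    rewrite rhoE; apply/eqP/eqP => [->|]; first by rewrite mulfK ?expf_neq0 // mulVf.
    by move=> h; rewrite -[c]mulr1 -h mulVKf // divfK // expf_neq0.
  case: eqP => [->|/eqP rho1].
    rewrite (eq_bigr (fun=> 1)) => [|k _]; last by rewrite expr1n.
    by rewrite sumr_const card_ord mulVf ?scale1r.
  have rhoM : rho ^+ M = 1.
    rewrite rhoE exprMn exprVn cM invr1 mul1r exprMn exprVn -!exprM.
    by rewrite ![(_ * M)%N]mulnC !exprM zMM !expr1n invr1 mulr1.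
  have : (rho - 1) * \sum_(k < M) rho ^+ k = 0 by rewrite -subrX1 rhoM subrr.
  move/eqP; rewrite mulf_eq0 subr_eq0 (negPf rho1) => /eqP ->.
  by rewrite mulr0 scale0r.
have projr : proj (comb u s r) = comb u s [seq t <- r | good t].
  rewrite /comb (blin_sum proj_lin) big_filter [RHS]big_mkcond; apply: eq_bigr => t _.
  by rewrite (blinZ proj_lin) projmon; case: ifP => // _; rewrite scaler0.
have close : rnorm (w - comb u s [seq t <- r | good t]) < e.
  rewrite -projr -{1}projw -(blinB proj_lin); apply: le_lt_trans (rnorm_proj _) _; lra.
have small t : t \in r -> (2 * deg t < M)%N.
  move=> tr; apply: leq_ltn_trans hM; rewrite leq_pmul2l //.
  by rewrite (big_rem t tr) leq_addr.
exists [seq t <- r | good t].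
case E : [seq t <- r | good t] => [|t0 r0]; first by exists 0%N, 0%N; split => //; rewrite -E.
have t0r : t0 \in [seq t <- r | good t] by rewrite E mem_head.
rewrite -E; case: t0 t0r {E} => [l0 [[[a0 p0] q0] b0]].
rewrite mem_filter => /andP[/= /eqP g0 /small/= d0].
exists p0, q0; split; last exact: close.
apply/allP => -[l [[[a p] q] b]]; rewrite mem_filter => /andP[/= /eqP g1 /small/= d1].
have : z ^+ (p + q0) == z ^+ (p0 + q).
  by rewrite !exprD g0 g1 mulrAC.
by rewrite (eq_prim_root_expr zM) !modn_small //; lia.
Qed.
End Homogeneous.

(** * The commutant of the group *)

Section Commutant.
Context {R : realType} {G : zmodType} (theta : {additive G -> G}).
Hypotheses (theta_inj : injective theta)
  (theta_coker : finite_set (cokernel theta))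
  (theta_exact : \bigcap_(n in [set: nat]) range (iter n theta) = [set 0]).
Variables (A : cstarAlgType R) (u : G -> A) (s : A).
Hypothesis rel : defining_relations theta u s.
Implicit Types (x y : A) (g h a b : G) (n m p q d : nat).

Lemma iter_theta_inj n : injective (iter n theta).
Proof. by elim: n => //= n IH g h /theta_inj/IH. Qed.

Lemma iter_theta_neq n m h : h <> 0 -> n <> m -> iter n theta h <> iter m theta h.
Proof.
have lt k l : (k < l)%N -> h <> 0 -> iter k theta h <> iter l theta h.
  move=> kl h0 E; apply: (@not_fixed _ _ theta_exact h (l - k)%N h0).
    by rewrite subn_gt0.
  apply: (@iter_theta_inj k); rewrite E -iterD subnKC //; exact: ltnW.
move=> h0 /eqP; rewrite neq_ltn => /orP[/lt/(_ h0)//|/lt/(_ h0) ne /esym //].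
Qed.

(** When h is moved far enough by theta, u_(theta^n h) commutes with
    u_a s^p s^*q u_b up to a left factor, which depends on the degree p - q only.
    In the exponent [n + p0 - q0] the subtraction is exact, because n >= q0 by
    the choice of [n0]. *)
Lemma conj_comb_of_degree r p0 q0 : all (of_degree p0 q0) r ->
  exists n0, forall n h, (n0 <= n)%N ->
  u (iter n theta h) * comb u s r * u (- iter n theta h)
  = u (iter n theta h - iter (n + p0 - q0) theta h) * comb u s r.
Proof.
rewrite /comb; elim: r => [|t r IH] /=.
  by move=> _; exists 0%N => n h _; rewrite !big_nil !mulr0 mul0r.
move=> /andP[tP /IH[n0 hn0]].
case: t tP => [l [[[a p] q] b]] /= /eqP pq.
exists (maxn n0 (maxn q q0)) => n h; rewrite !geq_max => /and3P[n0n qn q0n].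
rewrite !big_cons !mulrDr mulrDl hn0 //; congr (_ + _).
rewrite -scalerAr -scalerAl -scalerAr; congr (_ *: _); rewrite /=.
have -> : u (iter n theta h) * (u a * s ^+ p * star s ^+ q * u b) * u (- iter n theta h)
    = u (iter n theta h) * u a
      * (s ^+ p * (star s ^+ q * u (iter q theta (- iter (n - q) theta h)))) * u b.
  rewrite -!mulrA; do 4! congr (_ * _).
  by rewrite iter_thetaN -iterD subnKC // !(u_mul rel) addrC.
rewrite -(u_sstar rel) [s ^+ p * _]mulrA (s_u rel) iter_thetaN -iterD !mulrA.
do 3! congr (_ * _); rewrite !(u_mul rel); congr u; rewrite addrAC.
by congr (_ - iter _ theta h + _); lia.
Qed.

(** If the degree were not 0, conjugation by u_g would multiply the
    approximation by some u_k with k <> 0, but it fixes w. Thus 1 - u_k would be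
    small, against [rnorm_u_sub1]. *)
Lemma unitary_commutant_degree w r p0 q0 h :
  h <> 0 -> unitary w -> (forall g, u g * w = w * u g) ->
  all (of_degree p0 q0) r -> rnorm (w - comb u s r) < 2^-1 -> p0 = q0.
Proof.
move=> h0 [_ ww] wu rP wr; apply/eqP; apply: contraT => /eqP pq.
have [n0 hn] := conj_comb_of_degree rP.
pose n := (n0 + q0)%N; have {hn} := hn n h (leq_addr _ _).
set g := iter n theta h; set k := g - _ => hn.
have k0 : k <> 0.
  move/eqP; rewrite subr_eq0 => /eqP; apply: iter_theta_neq => //.
  by rewrite /n; lia.
have := rnorm_u_sub1 theta_exact rel k0.
have -> : 1 - u k = (u g * (w - comb u s r) * u (- g) - u k * (w - comb u s r)) * star w.
  have -> : u g * (w - comb u s r) * u (- g) = w - u k * comb u s r.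
    by rewrite mulrBr mulrBl hn wu -mulrA (u_opp rel) mulr1.
  by rewrite mulrBr opprB addrA subrK mulrBl ww -mulrA ww mulr1.
have wn : rnorm (star w) = 1.
  by apply: rnorm_isometry; rewrite starK.
set d := w - _ in wr *.
have := rnormM (u g * d * u (- g) - u k * d) (star w); rewrite wn mulr1.
have := rnormD (u g * d * u (- g)) (- (u k * d)); rewrite rnormN.
have := rnorm_conj rel g d; have := rnormM (u k) d; rewrite (rnorm_u rel) mul1r; lra.
Qed.

(** Averaging over cosets fixes w and sends the monomials of degree 0 into the
    group algebra, without increasing the distance. *)
Lemma diagonal_near_group_algebra w r p0 : (forall g, u g * w = w * u g) ->
  all (of_degree p0 p0) r ->
  exists2 c, group_algebra u c & rnorm (w - c) <= rnorm (w - comb u s r).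
Proof.
move=> wu rP.
pose k := (\sum_(t <- r) let: (_, (_, p, _, _)) := t in p)%N.
exists (averages theta u k (comb u s r)); last first.
  rewrite -{1}(averages_fix theta_coker rel k wu).
  rewrite -(blinB (averages_blin theta u k)).
  exact: (rnorm_averages theta_coker rel).
have [_ C0 Cl _ _] := group_algebra_subalgebra u.
rewrite /comb (blin_sum (averages_blin theta u k)) big_seq.
apply: (big_ind (group_algebra u)) => // [x y Cx Cy|t tr].
  by rewrite -[x]scale1r; exact: Cl.
rewrite (blinZ (averages_blin theta u k)) -[_ *: _]addr0; apply: Cl => //.
have /allP/(_ t tr) := rP.
have : ((let: (_, (_, p, _, _)) := t in p) <= k)%N by rewrite /k (big_rem t tr) leq_addr.
case: t {tr} => [l [[[a p] q] b]] /= pk /eqP.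
rewrite addnC => /addnI qp; rewrite -qp.
exact: (averages_monomial theta_coker rel).
Qed.

End Commutant.

(** * Scalars and the shift endomorphism on the group algebra *)

Section GroupAlgebra.
Context {R : realType} {G : zmodType} (theta : {additive G -> G}).
Variables (A : cstarAlgType R) (u : G -> A) (s : A).
Hypothesis rel : defining_relations theta u s.

Lemma group_algebra_induction (P : set A) : closed_subspace P ->
  (forall g, P (u g)) -> group_algebra u `<=` P.
Proof.
move=> Psub Pu; have mul_u g m : range u m -> range u (u g * m).
  by move=> [h _ <-]; exists (g + h) => //; rewrite (u_mul rel).
apply: (@generated_induction R A (range u) (range u)) => //.
- by exists 0 => //; rewrite (u_zero rel).
- by move=> _ m [g _ <-] um; right; exact: mul_u.
- by move=> _ m [g _ <-] um; right; rewrite (u_star rel); exact: mul_u.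
- by move=> _ [g _ <-].
Qed.

Lemma commute_group_algebra (y : A) : (forall g, u g * y = y * u g) ->
  forall x, group_algebra u x -> x * y = y * x.
Proof.
move=> yu; apply: group_algebra_induction => //.
exact: closed_subspace_eq (blin_mulr y) (blin_mull y).
Qed.

Lemma gauge_group_algebra z gam x : gauge u s z gam -> group_algebra u x -> gam x = x.
Proof.
move=> [gm gu _]; move: x; apply: group_algebra_induction => //.
exact: closed_subspace_eq (star_morphism_blin gm) (@blin_id R A).
Qed.

Lemma gauge_relations z : Num.conj z * z = 1 -> defining_relations theta u (z *: s).
Proof.
move=> zz; have zz' : z * Num.conj z = 1 by rewrite mulrC.
have zsz (x y : A) : z *: x * star (z *: y) = x * star y.
  by rewrite starZ -scalerAr -scalerAl scalerA zz scale1r.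
split.
- exact: rel_unitary rel.
- exact: rel_mul rel.
- by rewrite starZ -scalerAr -scalerAl scalerA zz' scale1r (rel_isometry rel).
- by move=> g; rewrite -scalerAl -scalerAr (rel_intertwine rel).
- move=> g gout; rewrite starZ -!scalerAl -scalerAr (rel_orthogonal rel) //.
  by rewrite !scaler0.
- rewrite -(rel_sum rel); apply: eq_fsbigr => c _.
  by rewrite -scalerAr zsz.
Qed.

Section Eps.
Variable iota : (dual R G -> R[i]^o) -> A.
Hypothesis iotaP : is_identification u iota.
Let u0 := u_zero rel.

Lemma epsB a b : group_algebra u a -> group_algebra u b ->
  eps iota (b - a) = eps iota b - eps iota a.
Proof.
move=> Ca Cb; have := eps_lin iotaP (-1) Ca Cb.
by rewrite scaleN1r mulN1r addrC [in RHS]addrC.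
Qed.

(** The group algebra is closed and contains the scalars, hence also q; on it,
    the bounded functional [eps] recovers the limit of the scalars. *)
Lemma near_scalar (q : A) :
  (forall e : R, 0 < e -> exists c : R[i], rnorm (q - c *: 1) < e) ->
  q = eps iota q *: 1.
Proof.
move=> near; have [/closed_rnormP Ccl C0 Cl _ _] := group_algebra_subalgebra u.
have C1 : group_algebra u (1 : A) := group_algebra1 u0.
have Cscal (c : R[i]) : group_algebra u (c *: 1).
  by rewrite -[_ *: _]addr0; exact: Cl.
have Cq : group_algebra u q.
  by apply: Ccl => e /near[c qc]; exists (c *: 1).
have eps0 : eps iota 0 = 0 by rewrite -[X in eps _ X](subrr 1) epsB // subrr.
have eps_scal (c : R[i]) : eps iota (c *: 1) = c.
  by rewrite -[c *: 1]addr0 (eps_lin iotaP) // (eps1 iotaP u0) mulr1 eps0 addr0.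
apply/eqP; rewrite -subr_eq0; apply/eqP/rnorm_small => e e0.
have /near[c qc] : 0 < e / 3 by lra.
have Cqc : group_algebra u (q - c *: 1) by rewrite addrC -scaleNr; exact: Cl.
have := eps_bounded iotaP u0 Cqc; rewrite epsB // eps_scal => bound.
have -> : q - eps iota q *: 1 = (q - c *: 1) - (eps iota q - c) *: 1.
  by rewrite scalerBl opprB addrA subrK.
have := rnormD (q - c *: 1) (- ((eps iota q - c) *: 1)).
rewrite rnormN rnormZ rnorm_one; lra.
Qed.

Hypothesis theta_coker : finite_set (cokernel theta).

(** It suffices to check u_g, which goes to u_(theta g); both have value 1. *)
Lemma eps_shift_endo x : group_algebra u x ->
  group_algebra u (shift_endo theta u s x) /\
  eps iota (shift_endo theta u s x) = eps iota x.
Proof.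
have abl := shift_endo_blin theta u s.
have [Ccl C0 Cl _ _] := group_algebra_subalgebra u.
pose D := group_algebra u `&` [set x | group_algebra u (shift_endo theta u s x)].
have Dsub : closed_subspace D.
  apply: closed_subspaceI; first exact: subalgebra_closed_subspace (group_algebra_subalgebra u).
  apply: (closed_subspace_preimage abl).
  exact: subalgebra_closed_subspace (group_algebra_subalgebra u).
have D0 : D 0 by case: Dsub.
move=> Cx; suff : (D `&` [set x | eps iota (shift_endo theta u s x) = eps iota x]) x.
  by move=> [[]].
move: x Cx; apply: group_algebra_induction => [|g]; last first.
  rewrite /D /= (shift_endo_u theta_coker rel) !(eps_u iotaP).
  by split=> //; split; exact: group_algebra_u.
split.
- apply/closed_rnormP => x hx.
  have Dx : D x.
    case: Dsub => /closed_rnormP Dcl _ _; apply: Dcl => e /hx[y [Dy _] xy].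
    by exists y.
  split=> //; apply/eqP; rewrite -subr_eq0; apply/eqP/rnorm_small => e e0.
  have [K K0 hK] := blin_bound abl.
  have [|y [Dy ey] xy] := hx (e / (2 * (K + 1))).
    by apply: divr_gt0 => //; lra.
  have [_ _ Dl] := Dsub.
  have [Cd Cad] : D (x - y) by rewrite addrC -scaleN1r; exact: Dl.
  have -> : eps iota (shift_endo theta u s x) - eps iota x =
      eps iota (shift_endo theta u s (x - y)) - eps iota (x - y).
    rewrite (blinB abl) !epsB //; try by case: Dx; case: Dy.
    by rewrite ey opprB addrA subrK.
  have := rnormD (eps iota (shift_endo theta u s (x - y))) (- eps iota (x - y)).
  rewrite rnormN; have := eps_bounded iotaP u0 Cd; have := eps_bounded iotaP u0 Cad.
  have := hK (x - y); move: xy; rewrite ltr_pdivlMr; last by lra.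
  lra.
- by split => //=; rewrite (blin0 abl).
- move=> a x y [Dx ex] [Dy ey]; case: (Dsub) => _ _ Dl; split; first exact: Dl.
  case: Dx Dy => Cx Cax [Cy Cay].
  by rewrite /= (blinD abl) (blinZ abl) !(eps_lin iotaP) // ex ey.
Qed.

End Eps.
End GroupAlgebra.

(** * The trivial group *)

Section TrivialGroup.
Context {R : realType} {G : zmodType} (theta : {additive G -> G}).
Variables (A : cstarAlgType R) (u : G -> A) (s : A).
Hypothesis rel : defining_relations theta u s.
Hypothesis gen : cstar_generated (range u `|` [set s]) = [set: A].

(** There is only one coset, so s is unitary and generates a commutative
    algebra. *)
Lemma trivial_group_commute : (forall g : G, g = 0) -> forall x, x * s = s * x.
Proof.
move=> G0; have u1 g : u g = 1 by rewrite (G0 g) (u_zero rel).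
have ss : s * star s = 1.
  have := rel_sum rel.
  have -> : cokernel theta = [set [set: G]].
    apply/seteqP; split=> [_ [g _ <-]|_ ->] /=.
      by apply/seteqP; split=> // h _; exists 0 => //; rewrite (G0 h) (G0 (_ + _)).
    exists 0 => //; apply/seteqP; split=> // h _.
    by exists 0 => //; rewrite (G0 h) (G0 (_ + _)).
  by rewrite fsbig_set1 !u1 star1 mul1r mulr1.
apply: (monomial_induction rel gen (closed_subspace_eq (blin_mulr s) (blin_mull s))).
move=> [[[a p] q] b] /=; rewrite !u1 mul1r mulr1.
apply/commr_sym/commrM; first exact: commrX.
by apply: commrX; rewrite /GRing.comm ss (rel_isometry rel).
Qed.
End TrivialGroup.

(** * Outerness *)

Theorem proposition6p14 (R : realType) (G : zmodType)
    (theta : {additive G -> G})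
    (G_countable : countable [set: G])
    (theta_inj : injective theta)
    (theta_coker : finite_set (cokernel theta))
    (theta_exact : \bigcap_(n in [set: nat]) range (iter n theta) = [set 0])
    (Q : cstarAlgType R) (u : G -> Q) (s : Q)
    (Q_universal : is_universal theta u s)
    (iota : (dual R G -> R[i]^o) -> Q)
    (iota_ident : is_identification u iota)
    (f : dual R G -> R[i]^o)
    (f_continuous : continuous f)
    (f_circle : forall chi, `|f chi| = 1)
    (f_trivial : f (trivial_character R G) <> 1)
    (beta : Q -> Q)
    (beta_f : is_beta u s (iota f) beta) :
  outer beta.
Proof.
have [rel gen univ] := Q_universal; have u0 := u_zero rel.
have [_ beta_u beta_s] := beta_f.
move=> [w [wU beta_w]]; have [w1 w2] := wU.
set F := iota f in beta_s.
have CF : group_algebra u F by exact: group_algebra_iota.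
have FF : star F * F = 1.
  have cf := continuous_conj f_continuous.
  rewrite -(ident_star iota_ident f_continuous) -(ident_mul iota_ident cf f_continuous).
  rewrite -(iota1 iota_ident u0); congr iota; apply/funext => chi.
  by rewrite mulrC -normCK f_circle expr1n.
have wu g : u g * w = w * u g.
  by rewrite -{1}(beta_u g) beta_w -mulrA w1 mulr1.
have ws : w * s = F * s * w by rewrite -beta_s beta_w -mulrA w1 mulr1.
have [[g0 g0_neq0]|G_trivial] := pselect (exists g : G, g <> 0); last first.
  have G0 (g : G) : g = 0.
    by apply/eqP; apply: contraT => /eqP g0; case: G_trivial; exists g.
  have F1 : F = 1.
    have sw := trivial_group_commute rel gen G0 w.
    have ss : s * star s = 1.
      have <- := trivial_group_commute rel gen G0 (star s); exact: rel_isometry rel.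
    have : F * (s * w) * star w * star s = s * w * star w * star s.
      by rewrite [F * _]mulrA -ws sw.
    by rewrite -!mulrA ![w * (star w * _)]mulrA w2 !mul1r ss mulr1.
  apply: f_trivial.
  suff -> : f = fun=> 1 by [].
  have c1 := @cst_continuous (dual R G) R[i]^o 1.
  by apply: (ident_inj iota_ident f_continuous c1); rewrite (iota1 iota_ident u0).
have starFF : F * star F = 1.
  by rewrite (group_algebra_comm iota_ident) //; exact: group_algebra_star.
have star_wu g : u g * star w = star w * u g.
  by have := congr1 star (wu (- g)); rewrite !star_mul (u_star rel) opprK => ->.
have star_ws : star w * s = star F * s * star w.
  have E : s * star w = F * star w * s.
    have -> : F * star w = star w * F.
      exact: (commute_group_algebra rel star_wu CF).
    by rewrite -[LHS]mul1r -w1 -!mulrA [w * (s * _)]mulrA ws -!mulrA w2 mulr1.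
  by rewrite -mulrA E !mulrA FF mul1r.
(* The unitary gam(w) w^* commutes with s and all u_g, because w and gam(w)
   satisfy the same commutation rules; so it is a scalar. *)
have w_gauge z : Num.conj z * z = 1 -> exists2 gam, gauge u s z gam &
    exists c, gam w = c *: w.
  move=> zz; have [gam [[gm gu gs] _]] := univ Q u (z *: s) (gauge_relations rel zz).
  have gP : gauge u s z gam by split.
  exists gam => //; pose q := gam w * star w.
  have gwu g : u g * gam w = gam w * u g by rewrite -(gu g) -!(morphM gm) wu.
  have gws : gam w * s = F * s * gam w.
    have := congr1 gam ws; rewrite !(morphM gm) gs (gauge_group_algebra rel gP CF).
    rewrite -scalerAr -scalerAr -scalerAl => /(congr1 (fun x => Num.conj z *: x)).
    by rewrite !scalerA zz !scale1r.
  have qu g : u g * q = q * u g by rewrite /q mulrA gwu -!mulrA star_wu.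
  have qs : s * q = q * s.
    rewrite /q -[RHS]mulrA star_ws !mulrA.
    have -> : gam w * star F = star F * gam w.
      by apply/esym/(commute_group_algebra rel gwu); exact: group_algebra_star.
    by rewrite -[star F * gam w * s]mulrA gws !mulrA FF mul1r.
  exists (eps iota q).
  have qE : q = eps iota q *: 1.
    apply: (near_scalar rel iota_ident).
    exact: (central_near_scalar theta_exact rel gen g0_neq0).
  by rewrite -[LHS]mulr1 -w1 mulrA -/q {1}qE -scalerAl mul1r.
(* w is close to combinations of one degree, which must be 0 *)
have Cw : group_algebra u w.
  have [/closed_rnormP Ccl _ _ _ _] := group_algebra_subalgebra u.
  have w_neq0 : w <> 0 by move=> w0; have := rnorm_unitary wU; rewrite w0 rnorm0; lra.
  apply: Ccl => e e0.
  have e'0 : 0 < Num.min e 2^-1 by rewrite lt_min e0 invr_gt0 ltr0n.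
  have [r [p0 [q0 [rP]]]] := homogeneous_approximation rel gen w_neq0 w_gauge e'0.
  rewrite lt_min => /andP[wr wr2].
  have pq := unitary_commutant_degree theta_inj theta_exact rel g0_neq0 wU wu rP wr2.
  rewrite -pq in rP.
  have [c Cc wc] := diagonal_near_group_algebra theta_coker rel wu rP.
  by exists c => //; exact: le_lt_trans wc wr.
have Fu g : u g * F = F * u g.
  by apply: (group_algebra_comm iota_ident) => //; exact: group_algebra_u.
have wE := shift_endo_intertwine theta_coker rel wu Fu ws.
have [Caw eps_aw] := eps_shift_endo rel iota_ident theta_coker Cw.
(* the equation w = F alpha(w), evaluated at the trivial character *)
have eps_w : eps iota w = f (trivial_character R G) * eps iota w.
  by rewrite {1}wE (epsM iota_ident) // eps_aw (eps_iota iota_ident).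
have eps_w0 : eps iota w != 0.
  apply/eqP => h; have := eps1 iota_ident u0.
  rewrite -w2 (epsM iota_ident) //; last exact: group_algebra_star.
  by rewrite h mul0r => /esym/eqP; rewrite oner_eq0.
by apply: f_trivial; apply: (mulIf eps_w0); rewrite -eps_w mul1r.
Qed.
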